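(* If $G$ is a non-faithful finite group of covariant dimension $2$, then $G$ is abelian of rank $2$.
   Context: The base field is $\mathbb{C}$; all modules are finite dimensional complex. A finite group is faithful if it admits a faithful irreducible complex representation, and non-faithful otherwise. A covariant of a finite group $G$ is a $G$-equivariant morphism (polynomial map) $\phi\colon V\to W$ of $G$-modules; $\dim\phi:=\dim\overline{\phi(V)}$; $\phi$ is faithful if $G$ acts faithfully on $\phi(V)$. The covariant dimension of $G$ is the minimum of $\dim\phi$ over all faithful covariants of $G$. The rank of a finite abelian group is its minimal number of generators. *)

(* Defs.v *)
From HB Require Import structures.
From mathcomp Require Import all_boot all_order all_algebra all_fingroup.
From mathcomp Require Import all_solvable mxrepresentation.
From mathcomp Require Import complex reals.
From mathcomp Require Import mpoly.

Set Implicit Arguments.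
Unset Strict Implicit.
Unset Printing Implicit Defensive.

Import GRing.Theory.
Local Open Scope ring_scope.

Section AffineSpace.
Variable F : fieldType.

(* The coordinate list [p] encodes the morphism v |-> (p_1(v), ..., p_m(v))
   of affine spaces. *)
Definition poly_map n m (p : 'I_m -> {mpoly F[n]}) (v : 'rV[F]_n) : 'rV[F]_m :=
  \row_j (p j).@[v 0].

Definition poly_map_image n m (p : 'I_m -> {mpoly F[n]}) (y : 'rV[F]_m) : Prop :=
  exists v : 'rV[F]_n, y = poly_map p v.

Definition zariski_closure m (A : 'rV[F]_m -> Prop) (x : 'rV[F]_m) : Prop :=
  forall q : {mpoly F[m]}, (forall a, A a -> q.@[a 0] = 0) -> q.@[x 0] = 0.

(* The restrictions h_i|_X are algebraically independent elements of the
   coordinate ring O(X) = F[x_1, ..., x_m] / I(X). *)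
Definition alg_independent_on m (X : 'rV[F]_m -> Prop) d
    (h : 'I_d -> {mpoly F[m]}) : Prop :=
  forall Q : {mpoly F[d]},
    (forall x, X x -> Q.@[fun i => (h i).@[x 0]] = 0) -> Q = 0.

(* The dimension of a closed subvariety X is the transcendence degree of O(X)
   over F, i.e. the largest size of an algebraically independent family.
   For irreducible X, such as the closure of the image of an affine space,
   this is the transcendence degree of the function field F(X). *)
Definition has_dim m (X : 'rV[F]_m -> Prop) (d : nat) : Prop :=
  (exists h : 'I_d -> {mpoly F[m]}, alg_independent_on X h) /\
  (forall e (h : 'I_e -> {mpoly F[m]}), alg_independent_on X h -> (e <= d)%N).

End AffineSpace.

Section Covariants.
Variables (F : fieldType) (gT : finGroupType) (G : {group gT}).

(* G-modules are matrix representations; as everywhere in mxrepresentation,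
   g acts on row vectors by v |-> v *m rV g. Passing to g^-1 turns these right
   modules into left modules with the same equivariant maps. *)
Definition covariant n m (rV : mx_representation F G n)
    (rW : mx_representation F G m) (phi : 'I_m -> {mpoly F[n]}) : Prop :=
  forall g, g \in G -> forall v : 'rV[F]_n,
    poly_map phi (v *m rV g) = poly_map phi v *m rW g.

Definition covariant_has_dim n m (phi : 'I_m -> {mpoly F[n]}) (d : nat) : Prop :=
  has_dim (zariski_closure (poly_map_image phi)) d.

Definition faithful_covariant n m (rV : mx_representation F G n)
    (rW : mx_representation F G m) (phi : 'I_m -> {mpoly F[n]}) : Prop :=
  covariant rV rW phi /\
  (forall g, g \in G ->
     (forall y, poly_map_image phi y -> y *m rW g = y) -> g = 1%g).

Definition has_covariant_dim (d : nat) : Prop :=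
  (exists n m (rV : mx_representation F G n) (rW : mx_representation F G m)
     (phi : 'I_m -> {mpoly F[n]}),
     faithful_covariant rV rW phi /\ covariant_has_dim phi d) /\
  (forall n m (rV : mx_representation F G n) (rW : mx_representation F G m)
     (phi : 'I_m -> {mpoly F[n]}) e,
     faithful_covariant rV rW phi -> covariant_has_dim phi e -> (d <= e)%N).

Definition faithful_group : Prop :=
  exists n (rG : mx_representation F G n), mx_irreducible rG /\ mx_faithful rG.

End Covariants.

(* Main.v *)
Require Import Defs.
From HB Require Import structures.
From mathcomp Require Import all_boot all_order all_algebra all_fingroup.
From mathcomp Require Import all_solvable mxrepresentation.
From mathcomp Require Import complex reals.
From mathcomp Require Import ssrcomplements mpoly.

(* Let phi : V -> W be a faithful covariant whose image has dimension at most 2,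
   and let U be the G-module spanned by the coordinates of phi in C[V].
   Polynomials with linearly independent leading exponents are algebraically
   independent, so the leading exponents of the elements of U span a space of
   rank at most 2.

   Let N <= G be elementary abelian of order p^d, and choose coordinates on V
   and W in which N is diagonal. The leading exponent of an N-eigenvector in U
   determines its N-weight modulo p, and N acts faithfully on U, so d <= 2.
   Suppose d = 2.
   - If g in G acts on N by x |-> x^t, the differences of the leading exponents
     of g phi_j and phi_j have total degree 0 and weight (t - 1) times that of
     phi_j. If t <> 1 mod p these span rank 2, and together with a nonconstant
     phi_j rank 3: a contradiction.
   - If N is central, the grading of C[V] by lifts of the N-weights to integers
     is G-stable. In a monomial order refining it, elements of U of the same
     multidegree have the same leading exponent, since otherwise the rank would
     be 3. Hence every g in G preserves the leading exponents of elements of U,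
     commutators act unipotently on U, and G is abelian.

   Finally, if G has no faithful irreducible representation and its elementary
   abelian subgroups have rank at most 2, then some normal N of order p^2 has
   all its subgroups of order p normal in G, that is, G acts on N by powers.
   Indeed, otherwise one builds a nonzero element of C[G] killed by the
   averaging idempotents of all minimal normal subgroups M; in the module it
   generates, no M has a nonzero fixed vector, so that every simple submodule is
   faithful. *)

Set Implicit Arguments.
Unset Strict Implicit.
Unset Printing Implicit Defensive.

Import Order.TTheory GRing.Theory Num.Theory.
Local Open Scope ring_scope.

(** * Polynomial functions over an infinite field *)

Section InfiniteField.
Variable F : numFieldType.

Lemma poly_fun_eq0 (p : {poly F}) : (forall x, p.[x] = 0) -> p = 0.
Proof.
move=> p0; apply/eqP/negPn/negP => nz_p.
have [s s_size [s_uniq _]] : exists2 s : seq F, (size p <= size s)%N & uniq s /\ True.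
  exists [seq i%:R | i <- iota 0 (size p)]; first by rewrite size_map size_iota.
  split=> //; rewrite map_inj_uniq ?iota_uniq // => i j /eqP.
  by rewrite eqr_nat => /eqP.
have/max_poly_roots : all (root p) s by apply/allP=> x _; rewrite /root p0.
by move/(_ nz_p s_uniq); rewrite ltnNge s_size.
Qed.

Lemma meval_muni n (p : {mpoly F[n.+1]}) (v : 'I_n.+1 -> F) :
  p.@[v] = (map_poly (meval (fun i => v (widen_ord (leqnSn n) i)))
             (muni p)).[v ord_max].
Proof.
rewrite muniE mevalE rmorph_sum horner_sum /=; apply: eq_bigr => m _.
rewrite -mul_polyC rmorphM /= map_polyC hornerCM map_polyXn hornerXn /= mevalZ mevalX -mulrA big_ord_recr /=.
by congr (_ * (_ * _)); apply: eq_bigr => i _; rewrite mnmE.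
Qed.

Lemma muni_eq0 n (p : {mpoly F[n.+1]}) : muni p = 0 -> p = 0.
Proof.
move=> p0; apply/mpolyP => m; rewrite mcoeff0; apply/eqP.
have [supp_m|] := boolP (m \in msupp p); last by rewrite mcoeff_msupp negbK.
have: (muni p)`_(m ord_max)@_[multinom m (widen_ord (leqnSn n) i) | i < n] = 0.
  by rewrite p0 coef0 mcoeff0.
rewrite muniE coef_sum raddf_sum /= (bigD1_seq m) ?msupp_uniq //=.
rewrite coefZ coefXn eqxx mulr1 mcoeffZ mcoeffX eqxx mulr1 => <-.
rewrite big1 ?addr0 // => m' ne_m'; rewrite coefZ coefXn.
have [eq_max|_] := eqVneq; last by rewrite mulr0 mcoeff0.
rewrite mulr1 mcoeffZ mcoeffX; have [eq_w|_] := eqVneq; last by rewrite mulr0.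
case/eqP: ne_m'; apply/mnmP => i; case: (unliftP ord_max i) => [j|] -> //.
have -> : lift ord_max j = widen_ord (leqnSn n) j.
  by apply/val_inj; rewrite /= /bump leqNgt ltn_ord.
by have := congr1 (fun x : 'X_{1..n} => x j) eq_w; rewrite !mnmE.
Qed.

Lemma mpoly_fun_eq0 n (p : {mpoly F[n]}) : (forall v, p.@[v] = 0) -> p = 0.
Proof.
elim: n p => [|n IHn] p p0.
  by have := p0 (fun _ => 0); rewrite [p]nvar0_mpolyC mevalC => ->.
apply: muni_eq0; apply/polyP => k; rewrite coef0; apply: IHn => v.
pose P := map_poly (meval v) (muni p).
suffices P0 : P = 0 by rewrite -(coef_map (meval v)) -/P P0 coef0.
apply: poly_fun_eq0 => x.
pose v' i := if unlift ord_max i is Some j then v j else x.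
have := p0 v'; rewrite meval_muni {2}/v' unlift_none => <-.
congr _.[_]; apply/polyP => i; rewrite !coef_map /=; apply: meval_eq => j.
rewrite /v'; have -> : widen_ord (leqnSn n) j = lift ord_max j.
  by apply/val_inj; rewrite /= /bump leqNgt ltn_ord.
by rewrite liftK.
Qed.

End InfiniteField.

(** * Leading monomials and algebraic independence *)

Section ModularRank.
Variables (K L : fieldType).

Lemma mxrank_mxsub_le (F : fieldType) m n m' n' (f : 'I_m' -> 'I_m) (g : 'I_n' -> 'I_n)
    (A : 'M[F]_(m, n)) : (\rank (mxsub f g A : 'M_(m', n')) <= \rank A)%N.
Proof.
rewrite mxsubrc rowsubE -[A in colsub g A]mulmx1 -mulmx_colsub.
exact: leq_trans (mxrankM_maxr _ _) (mxrankM_maxl _ _).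
Qed.

(* A maximal minor of A that is nonzero in K is a nonzero integer, which the
   injectivity of the cast to L preserves. *)
Lemma rank_intr_le m n (A : 'M[int]_(m, n)) :
  injective (intr : int -> L) ->
  (\rank (map_mx intr A : 'M[K]_(m, n)) <= \rank (map_mx intr A : 'M[L]_(m, n)))%N.
Proof.
move=> inj_intr; set AK : 'M[K]_(m, n) := map_mx intr A.
set AL : 'M[L]_(m, n) := map_mx intr A.
have freeR := maxrowsub_free AK; set f := maxrankfun AK in freeR.
have fullC : row_full (rowsub f AK)^T.
  by rewrite /row_full mxrank_tr -/(row_free _).
have unitB := fullrowsub_unit fullC; set g := fullrankfun fullC in unitB.
pose B : 'M[int]_(\rank AK) := mxsub f g A.
have detK : ((\det B)%:~R : K) != 0.
  rewrite -det_map_mx -det_tr; move: unitB; rewrite unitmxE unitfE.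
  by congr (\det _ != 0); apply/matrixP=> i j; rewrite !mxE.
have detL : ((\det B)%:~R : L) != 0.
  apply: contraNneq detK => detL0; have /inj_intr -> : (\det B)%:~R = 0%:~R :> L.
    by rewrite detL0.
  by [].
rewrite -[X in (X <= _)%N](_ : \rank (map_mx intr B : 'M[L]_(\rank AK)) = _).
  by rewrite map_mxsub mxrank_mxsub_le.
by apply: mxrank_unit; rewrite unitmxE unitfE det_map_mx.
Qed.
End ModularRank.

Section LeadingMonomials.
Variable F : fieldType.

Definition alg_free e n (f : 'I_e -> {mpoly F[n]}) : Prop :=
  forall Q : {mpoly F[e]}, Q \mPo [tuple f k | k < e] = 0 -> Q = 0.

(** Integer entries let the rank be taken both over [rat], where it bounds transcendence degree from
    below, and over ['F_p], where it detects weights. *)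
Definition lead_mx e n (f : 'I_e -> {mpoly F[n]}) : 'M[int]_(e, n) :=
  \matrix_(k, i) (mlead (f k) i)%:Z.

Definition lin_comb m n e (phi : 'I_m -> {mpoly F[n]}) (w : 'M[F]_(m, e)) (k : 'I_e) :=
  \sum_j w j k *: phi j.

(** Only families inside the span of [phi] are tested; in this form the bound survives linear
    recombination and any polynomial substitution. *)
Definition lin_trdeg_le m n (phi : 'I_m -> {mpoly F[n]}) (d : nat) : Prop :=
  forall e (w : 'M[F]_(m, e)), alg_free (lin_comb phi w) -> (e <= d)%N.

(** Linear independence of the exponent vectors gives distinct monomials of [Q] distinct leading
    exponents after substitution, so the largest one cannot cancel. *)
Lemma lead_mx_free_alg_free e n (f : 'I_e -> {mpoly F[n]}) :
  row_free (map_mx intr (lead_mx f) : 'M[rat]_(e, n)) -> alg_free f.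
Proof.
set A : 'M[rat]_(e, n) := map_mx _ _ => freeA Q Q0.
(* [mlead 0] is the zero exponent, so a vanishing [f k] would produce a zero row. *)
have nz_f k : f k != 0.
  apply/eqP=> fk0; have: delta_mx 0 k *m A = (0 : 'rV_e) *m A.
    by rewrite mul0mx -rowE; apply/rowP=> i; rewrite !mxE fk0 mlead0 mnm0E.
  by move/(row_free_inj freeA)/matrixP/(_ 0 k)/eqP; rewrite !mxE !eqxx oner_eq0.
pose key (M : 'X_{1..e}) : 'X_{1..n} := (\sum_(k < e) mlead (f k) *+ M k)%MM.
pose term (M : 'X_{1..e}) := \prod_(k < e) f k ^+ M k.
have nz_term M : term M != 0 by apply/prodf_neq0=> k _; rewrite expf_neq0.
have lead_term M : mlead (term M) = key M.
  rewrite mlead_prod => [|k _ _]; last by rewrite expf_neq0.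
  by apply: eq_bigr => k _; rewrite mleadX.
have inj_key : injective key.
  move=> M M' eq_key; apply/mnmP=> k.
  pose r (M : 'X_{1..e}) : 'rV[rat]_e := \row_k (M k)%:R.
  have rE M1 : r M1 *m A = \row_i (key M1 i)%:R.
    apply/rowP=> i; rewrite !mxE mnm_sumE natr_sum; apply: eq_bigr => j _.
    by rewrite !mxE mulmnE natrM mulrC.
  have: r M *m A = r M' *m A by rewrite !rE eq_key.
  by move/(row_free_inj freeA)/rowP/(_ k)/eqP; rewrite !mxE eqr_nat => /eqP.
apply: contra_eq Q0 => nz_Q.
have [M0 sM0 max_M0] : exists2 M0, M0 \in msupp Q &
    forall M, M \in msupp Q -> (key M <= key M0)%O.
  have supp_Q : msupp Q != [::] by rewrite msupp_eq0.
  have [M0 sM0 /eqP join_eq] := eq_bigjoin key le_total supp_Q.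
  exists M0 => [|M sM]; first exact: sM0.
  by rewrite -join_eq; apply: joins_sup_seq.
suffices: (Q \mPo [tuple f k | k < e])@_(key M0) != 0.
  by apply: contraNneq => ->; rewrite mcoeff0.
have -> : Q \mPo [tuple f k | k < e] = \sum_(M <- msupp Q) Q@_M *: term M.
  rewrite comp_mpolyE; apply: eq_bigr => M _; congr (_ *: _).
  by apply: eq_bigr => k _; rewrite tnth_mktuple.
rewrite raddf_sum /= (bigD1_seq M0) ?msupp_uniq //= big_seq_cond big1 => [|M].
  rewrite addr0 mcoeffZ; apply: mulf_neq0; first by rewrite -mcoeff_msupp.
  by rewrite -lead_term mleadc_eq0.
case/andP=> sM neM; rewrite mcoeffZ [(term M)@__]mcoeff_gt_mlead ?mulr0 //.
rewrite lead_term lt_neqAle.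
by rewrite (inj_eq inj_key) neM max_M0.
Qed.

(** A maximal free set of rows selects algebraically independent elements of the span. *)
Lemma rank_lead_mx_le m n (phi : 'I_m -> {mpoly F[n]}) d e (w : 'M[F]_(m, e)) :
  lin_trdeg_le phi d ->
  (\rank (map_mx intr (lead_mx (lin_comb phi w)) : 'M[rat]_(e, n)) <= d)%N.
Proof.
set A : 'M[rat]_(e, n) := map_mx _ _ => le_d.
pose w' := colsub (maxrankfun A) w.
have lead_w' : map_mx intr (lead_mx (lin_comb phi w')) = rowsub (maxrankfun A) A.
  have combE k : lin_comb phi w' k = lin_comb phi w (maxrankfun A k).
    by apply: eq_bigr => j _; rewrite !mxE.
  by apply/matrixP=> k i; rewrite !mxE combE.
apply: (le_d _ w' (lead_mx_free_alg_free _)); rewrite lead_w'.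
exact: maxrowsub_free.
Qed.

End LeadingMonomials.

(** * Linear substitutions *)

Section Equivariance.
Variable F : numFieldType.

Definition subst_mx n (A : 'M[F]_n) (f : {mpoly F[n]}) : {mpoly F[n]} :=
  f \mPo [tuple \sum_k A k i *: 'X_k | i < n].

Lemma meval_subst_mx n (A : 'M[F]_n) f (v : 'rV[F]_n) :
  (subst_mx A f).@[v 0] = f.@[(v *m A) 0].
Proof.
rewrite /subst_mx comp_mpoly_meval; apply: meval_eq => i.
rewrite tnth_mktuple raddf_sum mxE /=; apply: eq_bigr => k _.
by rewrite mevalZ mevalXU mulrC.
Qed.

Lemma eq_meval_rV n (f g : {mpoly F[n]}) :
  (forall v : 'rV[F]_n, f.@[v 0] = g.@[v 0]) -> f = g.
Proof.
move=> eq_fg; apply/eqP; rewrite -subr_eq0; apply/eqP/mpoly_fun_eq0 => v.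
have /eqP := eq_fg (\row_i v i); rewrite -subr_eq0 -mevalB => /eqP <-.
by apply: meval_eq => i; rewrite mxE.
Qed.

Lemma meval_lin_comb m n e (phi : 'I_m -> {mpoly F[n]}) (w : 'M_(m, e)) k (v : 'rV_n) :
  (lin_comb phi w k).@[v 0] = (poly_map phi v *m w) 0 k.
Proof.
rewrite /lin_comb raddf_sum mxE /=; apply: eq_bigr => j _.
by rewrite mevalZ !mxE mulrC.
Qed.

Variables (gT : finGroupType) (G : {group gT}) (n m : nat).
Variables (rV : mx_representation F G n) (rW : mx_representation F G m).
Variable phi : 'I_m -> {mpoly F[n]}.
Hypothesis cov_phi : covariant rV rW phi.

Lemma subst_lin_comb g e (w : 'M[F]_(m, e)) k : g \in G ->
  subst_mx (rV g) (lin_comb phi w k) = lin_comb phi (rW g *m w) k.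
Proof.
move=> Gg; apply: eq_meval_rV => v.
by rewrite meval_subst_mx !meval_lin_comb cov_phi // mulmxA.
Qed.

Lemma lin_comb1 k : lin_comb phi 1%:M k = phi k.
Proof.
rewrite /lin_comb (bigD1 k) //= mxE eqxx scale1r big1 ?addr0 // => j nejk.
by rewrite mxE (negPf nejk) scale0r.
Qed.

End Equivariance.

Section Weights.
Variables (F : numFieldType) (n : nat).

Lemma mcoeff_subst_diag (A : 'M[F]_n) f M : is_diag_mx A ->
  (subst_mx A f)@_M = f@_M * \prod_i A i i ^+ M i.
Proof.
move/is_diag_mxP=> diagA.
have termE (M' : 'X_{1..n}) : \prod_(i < n) tnth [tuple \sum_k A k i *: 'X_k | i < n] i ^+ M' i =
    (\prod_i A i i ^+ M' i) *: 'X_[M'] :> {mpoly F[n]}.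
  rewrite mpolyXE_id -scaler_prod; apply: eq_bigr => i _.
  rewrite tnth_mktuple (bigD1 i) //= big1 ?addr0 ?exprZn // => k neki.
  by rewrite diagA ?scale0r.
rewrite /subst_mx comp_mpolyE raddf_sum /=.
have [sM|] := boolP (M \in msupp f).
  rewrite (bigD1_seq M) ?msupp_uniq //= termE mcoeffZ mcoeffZ mcoeffX eqxx mulr1.
  rewrite [X in _ + X]big1 ?addr0 // => M' neM'.
  by rewrite termE !mcoeffZ mcoeffX (negPf neM') !mulr0.
move=> nsM; have /eqP -> : f@_M == 0 by rewrite mcoeff_eq0.
rewrite mul0r big_seq big1 // => M' sM'; rewrite termE !mcoeffZ mcoeffX.
by case: eqP sM' nsM => [->|_ _ _]; rewrite ?mulr0 // => ->.
Qed.

(** A diagonal substitution scales each monomial separately, so the eigenvalue can be read off at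
    the leading one. *)
Lemma weight_mlead (A : 'M[F]_n) f lam : is_diag_mx A -> f != 0 ->
  subst_mx A f = lam *: f -> lam = \prod_i A i i ^+ mlead f i.
Proof.
move=> diagA nz_f /(congr1 (mcoeff (mlead f))).
rewrite mcoeff_subst_diag // mcoeffZ mulrC => /mulIf -> //.
by rewrite mleadc_eq0.
Qed.

End Weights.

(** * Diagonalization of elementary abelian groups *)

Section Diagonalization.
Variable F : numClosedFieldType.

(** A root of 1 + X + ... + X^(p-1) has order dividing p, and it is not 1 because p is nonzero in
    characteristic 0. *)
Lemma prime_prim_root p : prime p -> exists z : F, p.-primitive_root z.
Proof.
move=> p_pr; have p_gt1 := prime_gt1 p_pr.
pose P : {poly F} := \poly_(i < p) 1.
have sizeP : size P = p by rewrite size_poly_eq ?oner_eq0.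
have /closed_rootP [z Pz0] : size P != 1%N by rewrite sizeP gtn_eqF.
have sum0 : \sum_(i < p) z ^+ i = 0.
  move/rootP: Pz0; rewrite horner_poly => {2}<-.
  by apply: eq_bigr => i _; rewrite mul1r.
have zp1 : z ^+ p = 1.
  by apply/eqP; rewrite -subr_eq0 subrX1 sum0 mulr0.
have [k prim_k k_dvd] := prim_order_exists (prime_gt0 p_pr) zp1.
have [_ dvd_p] := primeP p_pr.
exists z; have /pred2P [k1|<- //] := dvd_p _ k_dvd.
move: prim_k; rewrite k1 => /prim_expr_order; rewrite expr1 => z1.
move/eqP: sum0; rewrite z1; under eq_bigr do rewrite expr1n.
by rewrite sumr_const card_ord pnatr_eq0; move: p_gt1; case: (p).
Qed.

Lemma diagonalizable_root_unity n (A : 'M[F]_n.+1) p (z : F) :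
  p.-primitive_root z -> A ^+ p = 1 -> diagonalizable A.
Proof.
move=> prim_z Ap1; apply/diagonalizableP; exists [seq z ^+ i | i <- index_iota 0 p].
  rewrite map_inj_in_uniq ?iota_uniq // => i j; rewrite !mem_index_iota /= => ltip ltjp.
  by move/eqP; rewrite (eq_prim_root_expr prim_z) !modn_small // => /eqP.
rewrite big_map (factor_Xn_sub_1 prim_z); apply: mxminpoly_min.
by rewrite rmorphB rmorphXn /= horner_mx_X rmorph1 Ap1 subrr.
Qed.

Variables (gT : finGroupType) (G : {group gT}).

Lemma abelem_codiagonalizable p (N : {group gT}) n (rG : mx_representation F G n) :
  prime p -> (p.-abelem N)%g -> N \subset G ->
  exists2 B, B \in unitmx & forall x, x \in N -> is_diag_mx (B *m rG x *m invmx B).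
Proof.
move=> p_pr abelN sNG; have [z prim_z] := prime_prim_root p_pr.
have abN := centsP (abelem_abelian abelN).
have [|B uB /allP diagB] := (codiagonalizableP [seq rG x | x <- enum N]).1.
- split=> [_ _ /mapP [x Nx ->] /mapP [y Ny ->] | _ /mapP [x Nx ->]].
    rewrite !mem_enum in Nx Ny; have [Gx Gy] := (subsetP sNG x Nx, subsetP sNG y Ny).
    by rewrite /comm_mx -!repr_mxM // abN.
  rewrite mem_enum in Nx; have Gx := subsetP sNG x Nx.
  case: n rG => [|n] rG; first by exists 1%:M; rewrite ?unitmx1 //; apply/is_diag_mxP; case.
  apply: diagonalizable_root_unity prim_z _; rewrite -repr_mxX //.
  have [_ /(_ x Nx) ->] := abelemP p_pr abelN; exact: repr_mx1.
- exists B => // x Nx.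
  have := diagB (rG x) (map_f _ _); rewrite mem_enum => /(_ Nx) /=.
  by rewrite /similar_to conjumx.
Qed.

End Diagonalization.

(** A basis of N over ['F_p], transported from row vectors; the second clause is linear independence
    written multiplicatively. *)
Lemma abelem_generators (gT : finGroupType) (N : {group gT}) p d :
  prime p -> (p.-abelem N)%g -> #|N| = (p ^ d)%N ->
  exists h : 'I_d -> gT, (forall l, h l \in N) /\
    (forall e : 'I_d -> 'F_p, (\prod_l h l ^+ e l = 1)%g -> forall l, e l = 0).
Proof.
move=> p_pr abelN cardN.
have abelV : (p.-abelem [set: 'rV['F_p]_d])%g.
  by apply: fin_Fp_lmod_abelem.
have /isogP [f injf imf] : [set: 'rV['F_p]_d] \isog N.
  by rewrite (isog_abelem_card _ abelV) abelN cardN cardsT card_mx mul1n card_Fp ?eqxx.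
exists (fun l => f (delta_mx 0 l)); split=> [l|e prod1 l].
  by rewrite -imf mem_morphim ?inE.
have : f (\row_l e l) = 1%g.
  rewrite -prod1 [\row_l e l]row_sum_delta.
  rewrite (morph_prod f) => [|i _]; last by rewrite inE.
  apply: eq_bigr => i _; rewrite mxE -[in LHS](natr_Zp (e i)).
  by rewrite scaler_nat -(morphX f) ?inE.
move/eqP; rewrite (morph_injm_eq1 injf) ?inE // => /eqP/rowP/(_ l).
by rewrite !mxE.
Qed.

(** * Linear combinations of the coordinates of a covariant *)

Section LinComb.
Variables (F : fieldType) (m n : nat).
Implicit Types phi : 'I_m -> {mpoly F[n]}.

Lemma lin_combB e phi (v w : 'M_(m, e)) k :
  lin_comb phi (v - w) k = lin_comb phi v k - lin_comb phi w k.
Proof.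
by rewrite -sumrB; apply: eq_bigr => j _; rewrite !mxE scalerBl.
Qed.

Lemma lin_combZ e phi a (w : 'M_(m, e)) k :
  lin_comb phi (a *: w) k = a *: lin_comb phi w k.
Proof.
by rewrite scaler_sumr; apply: eq_bigr => j _; rewrite !mxE scalerA.
Qed.

Lemma lin_comb0 e phi k : lin_comb phi (0 : 'M_(m, e)) k = 0.
Proof. by rewrite -[0](subrr 0) lin_combB subrr. Qed.

Lemma lin_comb_sum e phi I (r : seq I) (w : I -> 'M_(m, e)) k :
  lin_comb phi (\sum_(i <- r) w i) k = \sum_(i <- r) lin_comb phi (w i) k.
Proof.
rewrite [RHS]exchange_big; apply: eq_bigr => j _.
by rewrite summxE scaler_suml.
Qed.

Lemma lin_combM e e' phi (v : 'M_(m, e)) (w : 'M_(e, e')) k :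
  lin_comb phi (v *m w) k = lin_comb (lin_comb phi v) w k.
Proof.
rewrite /lin_comb; under [RHS]eq_bigr do rewrite scaler_sumr.
rewrite exchange_big; apply: eq_bigr => j _.
by rewrite mxE scaler_suml; apply: eq_bigr => i _; rewrite scalerA mulrC.
Qed.

Lemma eq_lin_comb e phi psi (w : 'M_(m, e)) k :
  phi =1 psi -> lin_comb phi w k = lin_comb psi w k.
Proof. by move=> eq_phi; apply: eq_bigr => j _; rewrite eq_phi. Qed.

Lemma lin_comb_diag phi (w : 'M_m) k :
  is_diag_mx w -> lin_comb phi w k = w k k *: phi k.
Proof.
move/is_diag_mxP=> diag_w; rewrite /lin_comb (bigD1 k) //= big1 ?addr0 // => j.
by move=> nejk; rewrite diag_w ?scale0r.
Qed.

Lemma lin_comb_comp n' e phi (t : n.-tuple {mpoly F[n']}) (w : 'M_(m, e)) k :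
  lin_comb (fun j => phi j \mPo t) w k = lin_comb phi w k \mPo t.
Proof.
by rewrite raddf_sum; apply: eq_bigr => j _; rewrite /= comp_mpolyZ.
Qed.

Lemma lead_mx_lin_comb_row e e' phi (v : 'M_(m, e)) (w : 'M_(m, e')) :
  lead_mx (lin_comb phi (row_mx v w)) =
  col_mx (lead_mx (lin_comb phi v)) (lead_mx (lin_comb phi w)).
Proof.
apply/matrixP=> k i; rewrite !mxE; case: splitP => k' def_k; rewrite !mxE.
  suff -> : lin_comb phi (row_mx v w) k = lin_comb phi v k' by [].
  by apply: eq_bigr => j _; have -> : k = lshift e' k' by [apply/val_inj]; rewrite row_mxEl.
suff -> : lin_comb phi (row_mx v w) k = lin_comb phi w k' by [].
by apply: eq_bigr => j _; have -> : k = rshift e k' by [apply/val_inj]; rewrite row_mxEr.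
Qed.

End LinComb.

Section Composition.
Variable F : numFieldType.

Lemma eq_meval n (f g : {mpoly F[n]}) : (forall v, f.@[v] = g.@[v]) -> f = g.
Proof. by move=> eq_fg; apply: eq_meval_rV => v; apply: eq_fg. Qed.

Lemma eq_alg_free e n (f g : 'I_e -> {mpoly F[n]}) : f =1 g -> alg_free f -> alg_free g.
Proof.
move=> eq_fg free_f Q; have -> : [tuple g k | k < e] = [tuple f k | k < e].
  by apply: eq_from_tnth => k; rewrite !tnth_mktuple.
exact: free_f.
Qed.

Lemma alg_free_comp e n n' (f : 'I_e -> {mpoly F[n]}) (t : n.-tuple {mpoly F[n']}) :
  alg_free (fun k => f k \mPo t) -> alg_free f.
Proof.
move=> free_ft Q Qf0; apply: free_ft; rewrite -[RHS](comp_mpoly0 t) -Qf0.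
apply: eq_meval => v; rewrite !comp_mpoly_meval; apply: meval_eq => k.
by rewrite !tnth_mktuple comp_mpoly_meval.
Qed.

Lemma lin_trdeg_le_comp m n n' (phi : 'I_m -> {mpoly F[n]}) (t : n.-tuple {mpoly F[n']}) d :
  lin_trdeg_le phi d -> lin_trdeg_le (fun j => phi j \mPo t) d.
Proof.
move=> le_d e w free_w; apply: (le_d e w); apply: (alg_free_comp (t := t)).
by apply: eq_alg_free free_w => k; apply: lin_comb_comp.
Qed.

Lemma lin_trdeg_le_lin_comb m m' n (phi : 'I_m -> {mpoly F[n]}) (v : 'M_(m, m')) d :
  lin_trdeg_le phi d -> lin_trdeg_le (lin_comb phi v) d.
Proof.
move=> le_d e w free_w; apply: (le_d e (v *m w)).
by apply: eq_alg_free free_w => k; rewrite lin_combM.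
Qed.

(** A relation between linear forms restricted to the closure of the image pulls back along [phi] to
    a relation between linear combinations of its coordinates. *)
Lemma has_dim_lin_trdeg m n (phi : 'I_m -> {mpoly F[n]}) d :
  covariant_has_dim phi d -> lin_trdeg_le phi d.
Proof.
case=> _ le_d e w free_w; apply: (le_d e (fun k => \sum_j w j k *: 'X_j)) => Q Q0.
apply: free_w; apply: eq_meval_rV => v; rewrite meval0 comp_mpoly_meval.
have closure_v : zariski_closure (poly_map_image phi) (poly_map phi v).
  by move=> q; apply; exists v.
rewrite -[RHS](Q0 _ closure_v); apply: meval_eq => k.
rewrite tnth_mktuple meval_lin_comb mxE raddf_sum; apply: eq_bigr => j _ /=.
by rewrite mevalZ mevalXU mulrC.
Qed.

End Composition.

(** * Gradings preserved by linear substitutions *)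

Section SubstSupport.
Variables (F : fieldType).

Definition mnm_weight n (om : 'I_n -> nat) (M : 'X_{1..n}) := (\sum_i om i * M i)%N.

Lemma mnm_weightD n om (M1 M2 : 'X_{1..n}) :
  mnm_weight om (M1 + M2)%MM = (mnm_weight om M1 + mnm_weight om M2)%N.
Proof. by rewrite -big_split; apply: eq_bigr => i _; rewrite mnmDE mulnDr. Qed.

Lemma mnm_weight_exp n om b (f : {mpoly F[n]}) a :
  {in msupp f, forall M, mnm_weight om M = b} ->
  {in msupp (f ^+ a), forall M, mnm_weight om M = (a * b)%N}.
Proof.
move=> supp_f; elim: a => [|a IHa] M.
  rewrite expr0 msupp1 inE => /eqP ->.
  by rewrite /mnm_weight big1 // => i _; rewrite mnm0E muln0.
rewrite exprS => /msuppM_le /allpairsP [[M1 M2] /= [s1 s2 ->]].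
by rewrite mnm_weightD supp_f // IHa.
Qed.

Lemma mnm_weight_prod n om (I : Type) (r : seq I) (f : I -> {mpoly F[n]}) b :
  (forall i, {in msupp (f i), forall M, mnm_weight om M = b i}) ->
  {in msupp (\prod_(i <- r) f i), forall M, mnm_weight om M = (\sum_(i <- r) b i)%N}.
Proof.
move=> supp_f; elim: r => [|i r IHr] M.
  rewrite !big_nil msupp1 inE => /eqP ->.
  by rewrite /mnm_weight big1 // => i _; rewrite mnm0E muln0.
rewrite !big_cons => /msuppM_le /allpairsP [[M1 M2] /= [s1 s2 ->]].
by rewrite mnm_weightD (supp_f i) // IHr.
Qed.

End SubstSupport.

(** Each variable is replaced by a linear form that is homogeneous for [om]. The witness [M'] is
    chosen before [om], so it serves all such gradings at once. *)
Lemma msupp_subst_mx (F : numFieldType) n (A : 'M[F]_n) f M : M \in msupp (subst_mx A f) ->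
  exists2 M', M' \in msupp f &
    forall om : 'I_n -> nat, (forall k i, A k i != 0 -> om k = om i) ->
      mnm_weight om M = mnm_weight om M'.
Proof.
rewrite /subst_mx comp_mpolyE => /msupp_sum_le /flatten_mapP [M' sM' sM].
exists M' => [|om om_A]; first by move: sM'; rewrite mem_filter.
have {}sM := msuppZ_le sM.
rewrite (_ : mnm_weight om M = \sum_i M' i * om i)%N.
  by apply: eq_bigr => i _; rewrite mulnC.
move: M sM; apply: mnm_weight_prod.
move=> i; apply: mnm_weight_exp => M1; rewrite tnth_mktuple.
move/msupp_sum_le/flatten_mapP=> [k _ sM1].
have nzA : A k i != 0 by apply: contraTneq sM1 => ->; rewrite scale0r msupp0.
have := msuppZ_le sM1; rewrite msuppX inE => /eqP ->.
rewrite /mnm_weight (bigD1 k) //= big1 => [|j nejk]; last first.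
  by rewrite mnm1E eq_sym (negPf nejk) muln0.
by rewrite mnm1E eqxx muln1 addn0; apply: om_A.
Qed.

(** * Weights of leading monomials *)

Section DiagRepr.
Variables (F : fieldType) (gT : finGroupType) (G N : {group gT}) (n : nat).
Variable rG : mx_representation F G n.
Hypotheses (sNG : N \subset G) (diagN : forall x, x \in N -> is_diag_mx (rG x)).

Lemma diag_reprM x y i : x \in N -> y \in N -> rG (x * y)%g i i = rG x i i * rG y i i.
Proof.
move=> Nx Ny; rewrite repr_mxM ?(subsetP sNG) // mxE (bigD1 i) //= big1 ?addr0 // => k.
by have /is_diag_mxP diag := diagN Nx; rewrite eq_sym => neik; rewrite diag ?mul0r.
Qed.

Lemma diag_reprX x k i : x \in N -> rG (x ^+ k)%g i i = rG x i i ^+ k.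
Proof.
move=> Nx; elim: k => [|k IHk]; first by rewrite repr_mx1 mxE eqxx.
by rewrite expgS diag_reprM ?groupX // IHk exprS.
Qed.

Lemma diag_repr_prod (I : Type) (r : seq I) (f : I -> gT) i : (forall l, f l \in N) ->
  rG (\prod_(l <- r) f l)%g i i = \prod_(l <- r) rG (f l) i i.
Proof.
move=> Nf; elim: r => [|l r IHr]; first by rewrite !big_nil repr_mx1 mxE eqxx.
by rewrite !big_cons diag_reprM ?group_prod // IHr.
Qed.

End DiagRepr.

Lemma eq_natr_Fp p a b : prime p -> (a%:R == b%:R :> 'F_p) = (a == b %[mod p])%N.
Proof.
by move=> p_pr; rewrite -val_eqE /= !val_Fp_nat.
Qed.

Lemma mxrank_mul_sub_ker (K : fieldType) m n q r (A : 'M[K]_(m, n)) (B : 'M_(n, q)) (D : 'M_(r, n)) :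
  (D <= A)%MS -> D *m B = 0 -> (\rank (A *m B) + \rank D <= \rank A)%N.
Proof.
move=> sDA DB0; rewrite -(mxrank_mul_ker A B) leq_add2l mxrankS // sub_capmx sDA.
exact/sub_kermxP.
Qed.

Lemma mnm_weight1 n (M : 'X_{1..n}) : mnm_weight (fun=> 1%N) M = mdeg M.
Proof. by rewrite mdegE; apply: eq_bigr => i _; rewrite mul1n. Qed.

Lemma mnm_weight_eq n (i : 'I_n) (M : 'X_{1..n}) : mnm_weight (fun j => j == i) M = M i.
Proof.
rewrite /mnm_weight (bigD1 i) //= eqxx mul1n big1 ?addn0 // => j /negPf ->.
by rewrite mul0n.
Qed.

Section WeightMatrix.
Variables (F : numFieldType) (gT : finGroupType) (G N : {group gT}).
Variables (n m : nat) (rho : gT -> 'M[F]_n) (rW : mx_representation F G m).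
Variable phi : 'I_m -> {mpoly F[n]}.

(* Equivariance is only required of the matrices rho g, not that rho be a
   representation of G. *)
Definition equivariant :=
  forall g k, g \in G -> subst_mx (rho g) (phi k) = lin_comb phi (rW g) k.

Definition faithful_comb :=
  forall g, g \in G -> (forall k, lin_comb phi (rW g) k = phi k) -> g = 1%g.

Hypotheses (eqv_phi : equivariant) (faith_phi : faithful_comb).

Lemma subst_equivariant g e (w : 'M[F]_(m, e)) k : g \in G ->
  subst_mx (rho g) (lin_comb phi w k) = lin_comb phi (rW g *m w) k.
Proof.
move=> Gg; rewrite /subst_mx -lin_comb_comp lin_combM; apply: eq_lin_comb => j.
exact: eqv_phi.
Qed.

Lemma lin_comb_repr_neq0 g e (w : 'M[F]_(m, e)) k : g \in G ->
  (lin_comb phi (rW g *m w) k == 0) = (lin_comb phi w k == 0).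
Proof.
move=> Gg; apply/idP/idP => /eqP f0; last first.
  by rewrite -subst_equivariant // f0 /subst_mx comp_mpoly0.
have := subst_equivariant (rW g *m w) k (groupVr Gg).
rewrite mulmxA -repr_mxM ?groupV // mulVg repr_mx1 mul1mx f0 /subst_mx comp_mpoly0.
by move=> <-.
Qed.

Variables (p d : nat) (z : F) (h : 'I_d -> gT) (c : 'I_n -> 'I_d -> nat).
Hypotheses (p_pr : prime p) (prim_z : p.-primitive_root z) (sNG : N \subset G).
Hypothesis hN : forall l, h l \in N.
Hypothesis h_free : forall e : 'I_d -> 'F_p, (\prod_l h l ^+ e l)%g = 1%g -> forall l, e l = 0.
Hypothesis diagV : forall x, x \in N -> is_diag_mx (rho x).
Hypothesis diagW : forall x, x \in N -> is_diag_mx (rW x).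
Hypothesis cE : forall i l, rho (h l) i i = z ^+ c i l.

Definition weight_mx : 'M[int]_(n, d) := \matrix_(i, l) (c i l)%:Z.

(** For an eigenvector [f] of [h l], this is an integral lift of the exponent of [z] in the
    eigenvalue. *)
Definition weight (f : {mpoly F[n]}) (l : 'I_d) := (\sum_i mlead f i * c i l)%N.

Lemma lead_mxM_weight e (f : 'I_e -> {mpoly F[n]}) k l :
  (lead_mx f *m weight_mx) k l = (weight (f k) l)%:Z.
Proof.
rewrite !mxE /weight (big_morph Posz (fun m n => erefl _ : (m + n)%:Z = m%:Z + n%:Z) (erefl _)).
by apply: eq_bigr => i _; rewrite !mxE PoszM.
Qed.

Lemma eigen_weight f l lam : f != 0 -> subst_mx (rho (h l)) f = lam *: f ->
  lam = z ^+ weight f l.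
Proof.
move=> nz_f; have diag_h := diagV (hN l); move/(weight_mlead diag_h nz_f) => ->.
rewrite /weight (big_morph (GRing.exp z) (exprD z) (expr0 z)).
by apply: eq_bigr => i _; rewrite cE -exprM mulnC.
Qed.

Lemma weight_repr l k : phi k != 0 -> rW (h l) k k = z ^+ weight (phi k) l.
Proof.
move=> nz_k; apply: eigen_weight => //.
by rewrite eqv_phi ?(subsetP sNG) // lin_comb_diag // diagW.
Qed.

(** A vector [v] over ['F_p] orthogonal to the weights of all [phi k] yields the element [x], the
    product of the [h l ^+ v 0 l], which fixes every [phi k]; faithfulness gives x = 1, and
    independence of the [h l] gives v = 0. *)
Lemma rank_weight_mx :
  \rank (map_mx intr (lead_mx phi *m weight_mx) : 'M['F_p]_(m, d)) = d.
Proof.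
set M : 'M['F_p]_(m, d) := map_mx _ _.
have ME k l : M k l = (weight (phi k) l)%:R by rewrite mxE lead_mxM_weight.
apply/eqP; rewrite -mxrank_tr; rewrite -/(row_free _) -kermx_eq0.
apply/negPn/negP => /rowV0Pn [v /sub_kermxP vM0 /eqP []].
pose x := (\prod_l h l ^+ v 0 l)%g.
have Nx : x \in N by rewrite group_prod // => l _; rewrite groupX.
have x1 : x = 1%g.
  apply: faith_phi => [|k]; first exact: (subsetP sNG).
  rewrite lin_comb_diag ?diagW //.
  have [->|nz_k] := eqVneq (phi k) 0; first by rewrite scaler0.
  rewrite (diag_repr_prod sNG) // => [|l]; last by rewrite groupX.
  suff -> : \prod_l rW (h l ^+ v 0 l)%g k k = 1 by rewrite scale1r.
  transitivity (z ^+ (\sum_l weight (phi k) l * v 0%R l)%N).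
    rewrite (big_morph (GRing.exp z) (exprD z) (expr0 z)); apply: eq_bigr => l _.
    by rewrite (diag_reprX sNG) // weight_repr // exprM.
  apply/eqP; rewrite -(prim_order_dvd prim_z) (dvdn_pcharf (pchar_Fp p_pr)).
  have /rowP/(_ k) := vM0; rewrite !mxE => <-; rewrite natr_sum; apply/eqP.
  by apply: eq_bigr => l _; rewrite [M^T _ _]mxE ME natrM natr_Zp mulrC.
by apply/rowP => l; rewrite mxE; apply: h_free x1 l.
Qed.


Lemma rank_lead_ge_Fp e (w : 'M[F]_(m, e)) D :
  lin_trdeg_le phi D -> (\rank (map_mx intr (lead_mx (lin_comb phi w)) : 'M['F_p]_(e, n)) <= D)%N.
Proof.
move=> le_D; apply: leq_trans (rank_lead_mx_le w le_D).
by apply: rank_intr_le; apply: intr_inj.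
Qed.

Lemma lead_mx1 : lead_mx (lin_comb phi 1%:M) = lead_mx phi.
Proof. by apply/matrixP=> k i; rewrite !mxE lin_comb1. Qed.

(** The weights are linear in the leading exponents, so d is at most the rank of [lead_mx phi]
    modulo p, hence at most its rational rank. *)
Lemma abelem_rank_le D : lin_trdeg_le phi D -> (d <= D)%N.
Proof.
move/(rank_lead_ge_Fp 1%:M); apply: leq_trans.
by rewrite lead_mx1 -[d in (d <= _)%N]rank_weight_mx map_mxM mxrankM_maxl.
Qed.

(** A monotone [key] preserved by the substitutions cannot grow at the leading monomial under g; the
    same for g^-1 gives equality. *)
Lemma lead_key_repr (disp : Order.disp_t) (T : orderType disp) (key : 'X_{1..n} -> T) :
  {homo key : M M' / (M <= M')%O} ->
  (forall g f M, g \in G -> M \in msupp (subst_mx (rho g) f) ->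
     exists2 M', M' \in msupp f & key M = key M') ->
  forall g e (w : 'M[F]_(m, e)) k, g \in G ->
    key (mlead (lin_comb phi (rW g *m w) k)) = key (mlead (lin_comb phi w k)).
Proof.
move=> homo_key compat_key.
have le_key g e (w : 'M[F]_(m, e)) k : g \in G ->
    (key (mlead (lin_comb phi (rW g *m w) k)) <= key (mlead (lin_comb phi w k)))%O.
  move=> Gg; have [f0|nz_f] := eqVneq (lin_comb phi w k) 0.
    have /eqP -> : lin_comb phi (rW g *m w) k == 0 by rewrite lin_comb_repr_neq0 // f0.
    by rewrite f0.
  have sM : mlead (lin_comb phi (rW g *m w) k) \in msupp (subst_mx (rho g) (lin_comb phi w k)).
    by rewrite subst_equivariant // mlead_supp // lin_comb_repr_neq0.
  have [M' sM' ->] := compat_key _ _ _ Gg sM.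
  by apply: homo_key; apply: msupp_le_mlead.
move=> g e w k Gg; apply/le_anti; rewrite le_key //=.
have := le_key g^-1%g _ (rW g *m w) k (groupVr Gg).
by rewrite mulmxA -repr_mxM ?groupV // mulVg repr_mx1 mul1mx.
Qed.

Lemma lead_mdeg_repr g e (w : 'M[F]_(m, e)) k : g \in G ->
  mdeg (mlead (lin_comb phi (rW g *m w) k)) = mdeg (mlead (lin_comb phi w k)).
Proof.
apply: lead_key_repr => [M M' /lemc_mdeg // | {}g f M Gg /msupp_subst_mx [M' sM' eqM]].
exists M' => //; by rewrite -!mnm_weight1; apply: eqM.
Qed.

(** [h l] acts on the translate of [phi k] by g as its conjugate, the t-th power of [h l], acts on
    [phi k]. *)
Lemma weight_conj g t k l : g \in G -> {in N, forall x, x ^ g = x ^+ t}%g ->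
  (weight (lin_comb phi (rW g) k) l)%:R = t%:R * (weight (phi k) l)%:R :> 'F_p.
Proof.
move=> Gg conj_g; have Gh := subsetP sNG _ (hN l).
have [k0|nz_k] := eqVneq (phi k) 0.
  have -> : lin_comb phi (rW g) k = 0.
    by apply/eqP; rewrite -[rW g]mulmx1 lin_comb_repr_neq0 // lin_comb1 k0.
  by rewrite k0 /weight mlead0 big1 ?mulr0 // => i _; rewrite mnm0E.
have nz_gk : lin_comb phi (rW g) k != 0.
  by rewrite -[rW g]mulmx1 lin_comb_repr_neq0 // lin_comb1.
rewrite -natrM; apply/eqP; rewrite eq_natr_Fp // -(eq_prim_root_expr prim_z).
rewrite mulnC exprM -weight_repr // -(diag_reprX sNG diagW) // -conj_g //; apply/eqP/esym.
apply: eigen_weight => //; rewrite subst_equivariant // -repr_mxM // conjgC.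
rewrite repr_mxM ?groupJ // lin_combM lin_comb_diag // diagW // conj_g ?groupX //.
Qed.

Lemma scalar_conj_trivial g t : g \in G -> {in N, forall x, x ^ g = x ^+ t}%g ->
  lin_trdeg_le phi d -> (0 < d)%N -> t%:R = 1 :> 'F_p.
Proof.
move=> Gg conj_g le_d d_gt0; apply/eqP/negPn/negP => neq_t1.
(* The family of the [phi k] followed by their translates under g; its leading exponents turn out to
   have rank at least d + 1. *)
pose w : 'M[F]_(m, m + m) := row_mx 1%:M (rW g).
pose B := lead_mx (lin_comb phi w); pose A : 'M[rat]_(m + m, n) := map_mx intr B.
pose D : 'M[int]_(m, n) := lead_mx (lin_comb phi (rW g)) - lead_mx phi.
have DE : D = row_mx (- 1%:M) 1%:M *m B.
  by rewrite /B lead_mx_lin_comb_row lead_mx1 mul_row_col mulNmx !mul1mx addrC.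
have sDA : (map_mx intr D <= A)%MS by rewrite DE map_mxM submxMl.
(* Modulo p the weights of the rows of [D] are t - 1 times those of the [phi k], which have rank
   d. *)
have rankD : (d <= \rank (map_mx intr D : 'M[rat]_(m, n)))%N.
  apply: leq_trans (rank_intr_le 'F_p _ (@intr_inj rat)).
  have DC : map_mx intr (D *m weight_mx) =
      (t%:R - 1) *: map_mx intr (lead_mx phi *m weight_mx) :> 'M['F_p]_(m, d).
    apply/matrixP=> k l; rewrite mulmxBl [LHS]mxE [X in X%:~R = _]mxE [RHS]mxE [X in _ = _ * X]mxE.
    rewrite [(- _ : 'M_(_, _)) _ _]mxE !lead_mxM_weight.
    have -> (a b : nat) : (a%:Z - b%:Z)%:~R = a%:R - b%:R :> 'F_p by rewrite intrB.
    by apply: etrans (congr1 (fun x => x - _) (weight_conj k l Gg conj_g)) _; rewrite mulrBl mul1r.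
  have := mxrankM_maxl (map_mx intr D : 'M['F_p]_(m, n)) (map_mx intr weight_mx).
  by rewrite -map_mxM DC mxrank_scale_nz ?subr_eq0 // rank_weight_mx.
(* The all-ones column computes total degrees, which g preserves. *)
have deg0 : map_mx intr D *m (const_mx 1 : 'cV[rat]_n) = 0.
  apply/matrixP=> k j; rewrite !mxE.
  transitivity ((mdeg (mlead (lin_comb phi (rW g *m 1%:M) k)))%:R -
                (mdeg (mlead (lin_comb phi (1%:M : 'M_m) k)))%:R : rat).
    rewrite !mdegE !natr_sum -sumrB mulmx1; apply: eq_bigr => i _.
    by rewrite !mxE mulr1 lin_comb1 intrB.
  by rewrite lead_mdeg_repr // subrr.
(* If all leading degrees of the [phi k] vanished, so would all their weights, whose rank is d >
   0. *)
have nz_A : (0 < \rank (A *m (const_mx 1%R : 'cV[rat]_n)))%N.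
  rewrite lt0n mxrank_eq0; apply/eqP=> A0.
  have L0 : lead_mx phi = 0.
    apply/matrixP=> k i; rewrite !mxE; congr Posz.
    have := congr1 (fun X : 'cV[rat]_(m + m) => X (lshift m k) 0) A0.
    rewrite /A /B lead_mx_lin_comb_row lead_mx1 !mxE.
    under eq_bigr => j _ do rewrite mxE col_mxEu !mxE mulr1.
    rewrite -natr_sum -mdegE => /eqP; rewrite pnatr_eq0 mdeg_eq0 => /eqP ->.
    exact: mnm0E.
  have := rank_weight_mx; rewrite L0 mul0mx map_mx0 mxrank0 => d0.
  by rewrite -d0 in d_gt0.
have := mxrank_mul_sub_ker sDA deg0; rewrite leqNgt => /negP; apply.
apply: leq_ltn_trans (rank_lead_mx_le w le_d) _.
by rewrite -add1n leq_add.
Qed.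

Section CommonLeadingMonomials.

(* The first d coordinates of the leading monomial of an element of the module
   spanned by phi are its N-weights, and the action of G preserves the degree
   in each of these d variables. *)
Variable ii : 'I_d -> 'I_n.
Hypothesis val_ii : forall l, ii l = l :> nat.
Hypothesis lead_ii : forall e (w : 'M[F]_(m, e)) k l,
  mlead (lin_comb phi w k) (ii l) = weight (lin_comb phi w k) l.
Hypothesis rho_ii : forall g k i l, g \in G -> rho g k i != 0 -> (k == ii l) = (i == ii l).
Hypothesis le_d : lin_trdeg_le phi d.

(** Otherwise the two leading exponents differ by a nonzero vector killed by the projection [U] onto
    the d weight coordinates. As [U] already has rank d on leading exponents, the total rank would
    exceed d. *)
Lemma eq_mlead e (v w : 'M[F]_(m, e)) k :
  (forall l, mlead (lin_comb phi v k) (ii l) = mlead (lin_comb phi w k) (ii l)) ->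
  mlead (lin_comb phi v k) = mlead (lin_comb phi w k).
Proof.
move=> eq_ii; apply/eqP/negPn/negP => ne_lead.
pose u := row_mx 1%:M (row_mx v w); pose A0 := lead_mx (lin_comb phi u).
pose A : 'M[rat]_(_, n) := map_mx intr A0.
pose U : 'M[int]_(n, d) := \matrix_(i, l) (i == ii l)%:R.
have UE q (X : 'M_(q, n)) j l : (X *m U) j l = X j (ii l).
  rewrite mxE (bigD1 (ii l)) //= mxE eqxx mulr1 big1 ?addr0 // => i neil.
  by rewrite mxE (negPf neil) mulr0.
pose r : 'rV[int]_(m + (e + e)) := row_mx 0 (row_mx (delta_mx 0 k) (- delta_mx 0 k)).
have rE : r *m A0 = row k (lead_mx (lin_comb phi v)) - row k (lead_mx (lin_comb phi w)).
  by rewrite /A0 !lead_mx_lin_comb_row !mul_row_col mul0mx add0r mulNmx -!rowE.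
have rankU : (d <= \rank (A *m map_mx intr U))%N.
  rewrite -map_mxM -[X in (X <= _)%N]rank_weight_mx.
  apply: leq_trans (rank_intr_le 'F_p _ (@intr_inj rat)).
  have -> : lead_mx phi *m weight_mx = row_mx 1%:M 0 *m (A0 *m U).
    rewrite mulmxA /A0 lead_mx_lin_comb_row mul_row_col mul1mx mul0mx addr0.
    by apply/matrixP=> j l; rewrite lead_mxM_weight UE lead_mx1 mxE -lin_comb1 lead_ii.
  by rewrite [map_mx _ (_ *m (_ *m _))]map_mxM mxrankM_maxr.
have nz_r : (0 < \rank (map_mx intr (r *m A0) : 'rV[rat]_n))%N.
  rewrite lt0n mxrank_eq0; apply: contra ne_lead => /eqP r0; apply/eqP/mnmP => i.
  have := congr1 (fun X : 'rV[rat]_n => X 0 i) r0.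
  by rewrite rE !mxE intrB => /eqP; rewrite subr_eq0 eqr_int => /eqP [].
have rU0 : map_mx intr (r *m A0) *m map_mx intr U = 0 :> 'M[rat]_(1, d).
  apply/matrixP=> j l; rewrite -map_mxM mxE UE rE !mxE eq_ii subrr; exact: rmorph0.
have srA : (map_mx intr (r *m A0) <= A)%MS by rewrite map_mxM submxMl.
have := mxrank_mul_sub_ker srA rU0; rewrite leqNgt => /negP; apply.
by apply: leq_ltn_trans (rank_lead_mx_le u le_d) _; rewrite -addn1 leq_add.
Qed.

Lemma take_lexi_homo q (s t : seq nat) :
  ((s : seqlexi nat) <= t)%O -> ((take q s : seqlexi nat) <= take q t)%O.
Proof.
elim: q s t => [|q IHq] [|x s] [|y t] //; rewrite !lexi_cons => /andP [-> /implyP st] /=.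
by apply/implyP=> /st /IHq.
Qed.

Lemma mlead_repr g e (w : 'M[F]_(m, e)) k : g \in G ->
  mlead (lin_comb phi (rW g *m w) k) = mlead (lin_comb phi w k).
Proof.
move=> Gg; apply: eq_mlead => l.
(* The monomial order compares total degrees and then exponents lexicographically, so this prefix is
   monotone; G preserves each of its entries. *)
pose key (M : 'X_{1..n}) : seqlexi nat := mdeg M :: take d M.
have nth_key M (l' : 'I_d) : nth 0%N (key M) l'.+1 = M (ii l').
  by rewrite /= nth_take // (mnm_nth 0%N) val_ii.
rewrite -!nth_key; congr (nth _ _ _).
apply: (lead_key_repr (key := key)) => // [M M' | g' f M Gg' /msupp_subst_mx [M' sM' eqM]].
  by rewrite leEmnm => /(take_lexi_homo d.+1).
exists M' => //; congr (_ :: _); first by rewrite -!mnm_weight1; apply: eqM.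
apply: (@eq_from_nth _ 0%N); rewrite !size_take !size_tuple // => i lt_i.
have ltid : (i < d)%N by apply: leq_trans lt_i _; case: ltnP => // /ltnW.
have := nth_key M (Ordinal ltid); have := nth_key M' (Ordinal ltid); rewrite /= => -> ->.
rewrite -!mnm_weight_eq; apply: eqM => k' i' nz_rho.
by rewrite (rho_ii _ Gg' nz_rho).
Qed.

(* With f = lin_comb phi w k, the combination lc(f) xf - lc(xf) f has a smaller
   leading monomial than f, and so does its image under y. *)
Lemma lead_coef_mul x y e (w : 'M[F]_(m, e)) k : x \in G -> y \in G ->
  let C v := (lin_comb phi v k)@_(mlead (lin_comb phi w k)) in
  C (rW (y * x)%g *m w) * C w = C (rW x *m w) * C (rW y *m w).
Proof.
move=> Gx Gy C.
have CZ a v : C (a *: v) = a * C v by rewrite /C lin_combZ mcoeffZ.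
have CB u v : C (u - v) = C u - C v by rewrite /C lin_combB mcoeffB.
pose v := C w *: (rW x *m w) - C (rW x *m w) *: w.
suffices : C (rW y *m v) = 0.
  rewrite mulmxBr -!scalemxAr mulmxA -repr_mxM // CB !CZ => /eqP.
  by rewrite subr_eq0 mulrC => /eqP.
have [L0|nz_L] := eqVneq (lin_comb phi v k) 0.
  by have /eqP := L0; rewrite -(lin_comb_repr_neq0 _ _ Gy) /C => /eqP ->; rewrite mcoeff0.
apply: mcoeff_gt_mlead; rewrite mlead_repr // lt_neqAle; apply/andP; split.
  apply: contra nz_L => /eqP lead_v; rewrite -mleadc_eq0 lead_v -/(C v) /v CB !CZ.
  by rewrite mulrC subrr.
rewrite /v lin_combB !lin_combZ; apply: le_trans (mleadB_le _ _) _.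
rewrite leUx !(le_trans (mleadZ_le _ _)) //.
by rewrite mlead_repr.
Qed.

(** By [lead_coef_mul], group elements scale leading coefficients multiplicatively, so xy and yx
    scale them equally. *)
Lemma commutator_lead_coef x y e (w : 'M[F]_(m, e)) k : x \in G -> y \in G ->
  let C v := (lin_comb phi v k)@_(mlead (lin_comb phi w k)) in
  C (rW (x * y * (y * x)^-1)%g *m w) = C w.
Proof.
move=> Gx Gy C; have Gyx : (y * x)%g \in G by rewrite groupM.
(* Then [w] is yx applied to [w0], and the commutator applied to [w] is xy applied to [w0]. *)
pose w0 := rW (y * x)^-1%g *m w.
have lead_w0 : mlead (lin_comb phi w0 k) = mlead (lin_comb phi w k).
  by rewrite mlead_repr ?groupV.
have [f0|nz_f] := eqVneq (lin_comb phi w0 k) 0.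
  have /eqP := f0; rewrite lin_comb_repr_neq0 ?groupV // => /eqP fw0.
  suff -> : C (rW (x * y * (y * x)^-1)%g *m w) = 0 by rewrite /C fw0 mcoeff0.
  rewrite /C; have /eqP -> : lin_comb phi (rW (x * y * (y * x)^-1)%g *m w) k == 0.
    by rewrite lin_comb_repr_neq0 ?fw0 // groupM ?groupV // groupM.
  exact: mcoeff0.
have wE : w = rW (y * x)%g *m w0.
  by rewrite mulmxA -repr_mxM ?groupV // mulgV repr_mx1 mul1mx.
have xywE : rW (x * y * (y * x)^-1)%g *m w = rW (x * y)%g *m w0.
  by rewrite repr_mxM ?groupV ?groupM // mulmxA.
rewrite xywE [w in RHS]wE /C -lead_w0.
have nzC : (lin_comb phi w0 k)@_(mlead (lin_comb phi w0 k)) != 0 by rewrite mleadc_eq0.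
by apply: (mulIf nzC); rewrite (lead_coef_mul w0 k Gx Gy) (lead_coef_mul w0 k Gy Gx) mulrC.
Qed.

(** The commutator [t] preserves leading coefficients and has finite order; averaging over its
    powers then shows that it fixes every [phi k]. *)
Lemma commutator_trivial x y : x \in G -> y \in G -> (x * y = y * x)%g.
Proof.
move=> Gx Gy; pose t := (x * y * (y * x)^-1)%g.
have Gt : t \in G by rewrite !(groupM, groupV).
suffices t1 : t = 1%g by apply/eqP; rewrite eq_mulgV1 -/t t1.
pose E := \sum_(i < #[t]%g) rW (t ^+ i)%g.
have tE : rW t *m E = E.
  rewrite /E mulmx_sumr; have := prednK (order_gt0 t); set q := #[t]%g.-1 => def_q.
  rewrite -def_q big_ord_recr big_ord_recl /= addrC.
  rewrite -repr_mxM ?groupX // -expgS def_q expg_order; congr (_ + _).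
  by apply: eq_bigr => i _; rewrite -repr_mxM ?groupX // -expgS.
have tiE i : rW (t ^+ i)%g *m E = E.
  elim: i => [|i IHi]; first by rewrite repr_mx1 mul1mx.
  by rewrite expgS repr_mxM ?groupX // -mulmxA IHi.
have EE : E *m E = (#[t]%g)%:R *: E.
  rewrite {1}/E mulmx_suml; under eq_bigr do rewrite tiE.
  by rewrite sumr_const card_ord scaler_nat.
have nz_ord : (#[t]%g)%:R != 0 :> F by rewrite pnatr_eq0 -lt0n order_gt0.
(* Up to the factor #[t], the projection away from the vectors fixed by [t]. [E] kills [u], yet it
   multiplies the leading coefficients of [u] by #[t], so these vanish. *)
pose u := (#[t]%g)%:R *: 1%:M - E.
have fu0 k : lin_comb phi u k = 0.
  pose C v := (lin_comb phi v k)@_(mlead (lin_comb phi u k)).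
  have Ci i : C (rW (t ^+ i)%g *m u) = C u.
    elim: i => [|i IHi]; first by rewrite repr_mx1 mul1mx.
    rewrite expgS repr_mxM ?groupX // -mulmxA -IHi /C -(mlead_repr u k (groupX i Gt)).
    exact: commutator_lead_coef.
  have : C (E *m u) = 0.
    by rewrite mulmxBr -scalemxAr mulmx1 EE subrr /C lin_comb0 mcoeff0.
  rewrite /E mulmx_suml /C lin_comb_sum raddf_sum /=.
  under eq_bigr do rewrite -/(C _) Ci.
  rewrite sumr_const card_ord -mulr_natl => /eqP; rewrite mulf_eq0 (negPf nz_ord) /=.
  by rewrite mleadc_eq0 => /eqP.
apply: faith_phi => // k; apply: (scalerI nz_ord); apply/eqP.
rewrite -subr_eq0 -(lin_comb1 phi k) -!lin_combZ -lin_combB.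
have -> : (#[t]%g)%:R *: rW t - (#[t]%g)%:R *: 1%:M = rW t *m u - u.
  by rewrite mulmxBr -scalemxAr mulmx1 tE opprB addrA addrNK.
by rewrite lin_combB fu0 subr0 lin_comb_repr_neq0 // fu0.
Qed.


End CommonLeadingMonomials.

End WeightMatrix.

(** * Elementary abelian subgroups and covariant dimension *)

Section DiagonalModel.
Variables (F : numFieldType) (gT : finGroupType) (G : {group gT}) (n m : nat).

Lemma subst_mxM (A B : 'M[F]_n) f : subst_mx A (subst_mx B f) = subst_mx (A *m B) f.
Proof. by apply: eq_meval_rV => v; rewrite !meval_subst_mx mulmxA. Qed.

Lemma subst_mx1 f : subst_mx (1%:M : 'M[F]_n) f = f.
Proof. by apply: eq_meval_rV => v; rewrite meval_subst_mx mulmx1. Qed.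

Variables (rV : mx_representation F G n) (rW : mx_representation F G m).
Variable phi : 'I_m -> {mpoly F[n]}.
Hypothesis fcov : faithful_covariant rV rW phi.

(** [psi] is [phi] read in the coordinates given by [B] on V and [C] on W. *)
Lemma conj_model (B : 'M[F]_n) (C : 'M[F]_m) (uB : B \in unitmx) (uC : C \in unitmx) d :
  lin_trdeg_le phi d ->
  exists psi : 'I_m -> {mpoly F[n]},
    [/\ equivariant (rconj_repr rV uB) (rconj_repr rW uC) psi,
        faithful_comb (rconj_repr rW uC) psi & lin_trdeg_le psi d].
Proof.
move=> le_d; have [cov faith] := fcov.
pose psi j := subst_mx B (lin_comb phi (invmx C) j).
have psiE e (w : 'M_(m, e)) k : lin_comb psi w k = subst_mx B (lin_comb phi (invmx C *m w) k).
  by rewrite lin_comb_comp -lin_combM.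
exists psi; split; last exact/lin_trdeg_le_comp/lin_trdeg_le_lin_comb.
  move=> g k Gg; rewrite psiE !rconj_mxE subst_mxM mulmxKV // -subst_mxM.
  by rewrite (subst_lin_comb cov) // !mulmxA mulVmx // mul1mx.
move=> g Gg psi_g; apply: faith => // _ [v ->].
apply/rowP=> k; rewrite -meval_lin_comb mxE; congr (_.@[_]).
have eqC j : lin_comb phi (rW g *m invmx C) j = lin_comb phi (invmx C) j.
  rewrite -[LHS]subst_mx1 -[RHS]subst_mx1 -(mulVmx uB) -!subst_mxM; congr subst_mx.
  rewrite -[RHS]/(psi j) -psi_g psiE !rconj_mxE !mulmxA mulVmx // mul1mx //.
rewrite -[rW g](mulmxKV uC) lin_combM (eq_lin_comb _ _ eqC) -lin_combM mulVmx //.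
exact: lin_comb1.
Qed.

End DiagonalModel.

Section Weights.
Variables (F : numFieldType) (gT : finGroupType) (G N : {group gT}) (n p d : nat).
Variables (z : F) (rV : mx_representation F G n) (h : 'I_d -> gT).

(** The bound by p makes the exponents functions of the eigenvalues: equal eigenvalues receive equal
    integral lifts. *)
Lemma weights_exist : prime p -> p.-primitive_root z -> (p.-abelem N)%g -> N \subset G ->
  (forall l, h l \in N) -> (forall x, x \in N -> is_diag_mx (rV x)) ->
  exists2 c : 'I_n -> 'I_d -> nat, forall i l, (c i l < p)%N &
    forall i l, rV (h l) i i = z ^+ c i l.
Proof.
move=> p_pr prim_z abelN sNG hN diagN.
have /fin_all_exists [c cP] (il : 'I_n * 'I_d) : exists k : 'I_p, rV (h il.2) il.1 il.1 = z ^+ k.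
  have : rV (h il.2) il.1 il.1 ^+ p = 1.
    rewrite -(diag_reprX sNG diagN) //; have [_ /(_ _ (hN il.2)) ->] := abelemP p_pr abelN.
    by rewrite repr_mx1 mxE eqxx.
  by case/(prim_rootP prim_z) => k ->; exists k.
by exists (fun i l => c (i, l)) => i l; rewrite ?ltn_ord // (cP (i, l)).
Qed.

End Weights.

(** * Recording the integral weights in extra variables *)

Section Extension.
Variables (F : numFieldType) (gT : finGroupType) (G : {group gT}) (n m d : nat).
Variables (rho : gT -> 'M[F]_n) (rW : mx_representation F G m) (phi : 'I_m -> {mpoly F[n]}).
Variable c : 'I_n -> 'I_d -> nat.
Hypotheses (eqv_phi : equivariant rho rW phi) (faith_phi : faithful_comb rW phi).
Hypothesis c_rho : forall g k i, g \in G -> rho g k i != 0 -> c k =1 c i.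

(* X_i |-> X_i * \prod_l T_l ^ c i l, where T_0, ..., T_(d-1) are the first d
   variables: the exponent of T_l records the grading with weights c _ l. *)
Definition ext_mnm i : 'X_{1..d + n} :=
  [multinom match split k with inl l => c i l | inr j => nat_of_bool (i == j) end | k < d + n].

Definition ext_tuple : n.-tuple {mpoly F[d + n]} := [tuple 'X_[ext_mnm i] | i < n].

(** G fixes the new variables T_l, which accordingly have weight 0 in [ext_weight]. *)
Definition ext_rho g : 'M[F]_(d + n) := block_mx 1%:M 0 0 (rho g).

Definition ext_weight (k : 'I_(d + n)) l := if split k is inr i then c i l else 0%N.

Definition ext_phi j := phi j \mPo ext_tuple.

Lemma ext_mnml i l : ext_mnm i (lshift n l) = c i l.
Proof. by rewrite mnmE (unsplitK (inl _)). Qed.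

Lemma ext_mnmr i j : ext_mnm i (rshift d j) = (i == j).
Proof. by rewrite mnmE (unsplitK (inr _)). Qed.

Lemma ext_weightl j l : ext_weight (lshift n j) l = 0%N.
Proof. by rewrite /ext_weight (unsplitK (inl j)). Qed.

Lemma ext_weightr i l : ext_weight (rshift d i) l = c i l.
Proof. by rewrite /ext_weight (unsplitK (inr i)). Qed.

Lemma meval_ext f (v : 'I_(d + n) -> F) :
  (f \mPo ext_tuple).@[v] =
  f.@[fun i => v (rshift d i) * \prod_l v (lshift n l) ^+ c i l].
Proof.
rewrite comp_mpoly_meval; apply: meval_eq => i.
rewrite tnth_mktuple mevalX big_split_ord mulrC /=; congr (_ * _).
  by apply: eq_bigr => l _; rewrite ext_mnml.
rewrite (bigD1 i) //= ext_mnmr eqxx big1 ?mulr1 // => j neji.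
by rewrite ext_mnmr eq_sym (negPf neji).
Qed.

(** By [c_rho], g mixes only variables of equal weights, so the monomial in the T_l attached to them
    factors out. *)
Lemma ext_equivariant : equivariant ext_rho rW ext_phi.
Proof.
move=> g k Gg; rewrite lin_comb_comp -eqv_phi //.
apply: eq_meval_rV => v; rewrite meval_subst_mx !meval_ext.
pose u := \row_i (v 0 (rshift d i) * \prod_l v 0 (lshift n l) ^+ c i l).
transitivity (subst_mx (rho g) (phi k)).@[u 0]; last first.
  by apply: meval_eq => i; rewrite mxE.
rewrite meval_subst_mx; apply: meval_eq => i.
have -> : v *m ext_rho g = row_mx (lsubmx v) (rsubmx v *m rho g).
  by rewrite -{1}[v]hsubmxK mul_row_block mulmx1 !mulmx0 addr0 add0r.
rewrite row_mxEr !mxE mulr_suml; apply: eq_bigr => j _.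
have [->|nz_ji] := eqVneq (rho g j i) 0; first by rewrite !mulr0 mul0r.
rewrite !mxE -!mulrA [rho g j i * _]mulrC; congr (_ * (_ * _)).
by apply: eq_bigr => l _; rewrite row_mxEl mxE (c_rho Gg nz_ji).
Qed.

Lemma ext_faithful : faithful_comb rW ext_phi.
Proof.
move=> g Gg ext_g; apply: faith_phi => // k; apply: eq_meval => v.
(* Setting every T_l to 1 recovers [phi]. *)
pose v' (k : 'I_(d + n)) := if split k is inr i then v i else 1 : F.
have := congr1 (meval v') (ext_g k); rewrite lin_comb_comp !meval_ext.
have v'E i : v' (rshift d i) * \prod_l v' (lshift n l) ^+ c i l = v i.
  rewrite /v' (unsplitK (inr _)) big1 ?mulr1 // => l _.
  by rewrite (unsplitK (inl _)) expr1n.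
by rewrite !(meval_eq _ v'E).
Qed.

(** The identity holds at every monomial of the composite: its T_l-exponent is the weight of the
    monomial of [f] it comes from. *)
Lemma ext_lead_weight f l :
  mlead (f \mPo ext_tuple) (lshift n l) = weight ext_weight (f \mPo ext_tuple) l.
Proof.
set g := f \mPo _; have [->|nz_g] := eqVneq g 0.
  by rewrite /weight mlead0 mnm0E big1 // => i _; rewrite mnm0E.
have := mlead_supp nz_g; rewrite /weight; move: (mlead g) => M; rewrite /g comp_mpolyE.
move/msupp_sum_le/flatten_mapP => [M' _ /msuppZ_le sM].
have suppX i (om : 'I_(d + n) -> nat) :
    {in msupp (tnth ext_tuple i), forall M1, mnm_weight om M1 = mnm_weight om (ext_mnm i)}.
  by move=> M1; rewrite tnth_mktuple msuppX inE => /eqP ->.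
have wM om := mnm_weight_prod (fun i => mnm_weight_exp (suppX i om)) sM.
have Ml l' : M (lshift n l') = (\sum_i M' i * c i l')%N.
  by rewrite -mnm_weight_eq wM; apply: eq_bigr => i _; rewrite mnm_weight_eq ext_mnml.
have Mr j : M (rshift d j) = M' j.
  rewrite -mnm_weight_eq wM (bigD1 j) //= mnm_weight_eq ext_mnmr eqxx muln1 big1 ?addn0 // => i neij.
  by rewrite mnm_weight_eq ext_mnmr (negPf neij) muln0.
rewrite Ml big_split_ord /= [X in _ = (X + _)%N]big1 ?add0n => [|j _]; last first.
  by rewrite ext_weightl muln0.
by apply: eq_bigr => i _; rewrite Mr ext_weightr.
Qed.

End Extension.

Section Conclusions.
Variables (F : numClosedFieldType) (gT : finGroupType) (G : {group gT}) (n m D : nat).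
Variables (rV : mx_representation F G n) (rW : mx_representation F G m).
Variable phi : 'I_m -> {mpoly F[n]}.
Hypotheses (fcov : faithful_covariant rV rW phi) (le_D : lin_trdeg_le phi D).

Lemma diagonal_model p d (N : {group gT}) :
  prime p -> (p.-abelem N)%g -> #|N| = (p ^ d)%N -> N \subset G ->
  exists (z : F) (h : 'I_d -> gT) (sV : mx_representation F G n)
    (sW : mx_representation F G m) (psi : 'I_m -> {mpoly F[n]}) (c : 'I_n -> 'I_d -> nat),
  [/\ p.-primitive_root z, forall l, h l \in N,
      forall e : 'I_d -> 'F_p, (\prod_l h l ^+ e l)%g = 1%g -> forall l, e l = 0,
      forall i l, (c i l < p)%N & forall i l, sV (h l) i i = z ^+ c i l] /\
  [/\ equivariant sV sW psi, faithful_comb sW psi, lin_trdeg_le psi D,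
      forall x, x \in N -> is_diag_mx (sV x) & forall x, x \in N -> is_diag_mx (sW x)].
Proof.
move=> p_pr abelN cardN sNG; have [z prim_z] := prime_prim_root F p_pr.
have [h [hN h_free]] := abelem_generators p_pr abelN cardN.
have [B uB diagB] := abelem_codiagonalizable rV p_pr abelN sNG.
have [C uC diagC] := abelem_codiagonalizable rW p_pr abelN sNG.
have [psi [eqv faith le_psi]] := conj_model fcov uB uC le_D.
have [c ltcp cE] := weights_exist (rV := rconj_repr rV uB) p_pr prim_z abelN sNG hN diagB.
by exists z, h, (rconj_repr rV uB), (rconj_repr rW uC), psi, c; split.
Qed.

Lemma abelem_logn_le p d (N : {group gT}) :
  prime p -> (p.-abelem N)%g -> #|N| = (p ^ d)%N -> N \subset G -> (d <= D)%N.
Proof.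
move=> p_pr abelN cardN sNG.
have [z [h [sV [sW [psi [c [[prim_z hN h_free ltcp cE]]]]]]]] :=
  diagonal_model p_pr abelN cardN sNG.
move=> [eqv faith le_psi diagV diagW].
exact: (abelem_rank_le eqv faith p_pr prim_z sNG hN h_free diagV diagW cE).
Qed.

Lemma scalar_action_trivial p (N : {group gT}) g t :
  prime p -> (p.-abelem N)%g -> #|N| = (p ^ D)%N -> N \subset G -> (0 < D)%N ->
  g \in G -> {in N, forall x, x ^ g = x ^+ t}%g -> {in N, forall x, x ^ g = x}%g.
Proof.
move=> p_pr abelN cardN sNG D_gt0 Gg conj_g.
have [z [h [sV [sW [psi [c [[prim_z hN h_free ltcp cE]]]]]]]] :=
  diagonal_model p_pr abelN cardN sNG.
move=> [eqv faith le_psi diagV diagW].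
have t1 := scalar_conj_trivial eqv faith p_pr prim_z sNG hN h_free diagV diagW cE Gg conj_g le_psi D_gt0.
move=> x Nx; rewrite conj_g // -[RHS]expg1; apply/eqP.
have [_ /(_ x Nx) xp1] := abelemP p_pr abelN.
have /eqP := t1; rewrite -[1 in X in X -> _]/(1%:R) eq_natr_Fp // => /eqP t1p.
by rewrite -(expg_mod t xp1) -(expg_mod 1 xp1) t1p.
Qed.

Lemma central_abelem_abelian p (N : {group gT}) :
  prime p -> (p.-abelem N)%g -> #|N| = (p ^ D)%N -> N \subset 'Z(G)%g -> abelian G.
Proof.
move=> p_pr abelN cardN sNZ; have sNG := subset_trans sNZ (center_sub G).
have [z [h [sV [sW [psi [c [[prim_z hN h_free ltcp cE]]]]]]]] :=
  diagonal_model p_pr abelN cardN sNG.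
move=> [eqv faith le_psi diagV diagW].
(* [sV g] commutes with the diagonal matrices of the central subgroup N, so a nonzero entry links
   only variables with equal eigenvalues. *)
have c_rho g k i : g \in G -> sV g k i != 0 -> c k =1 c i.
  move=> Gg nz_ki l; have Nh := hN l; have /is_diag_mxP diag_h := diagV _ Nh.
  have /(congr1 (fun A : 'M_n => A k i)) : sV g *m sV (h l) = sV (h l) *m sV g.
    have Gh := subsetP sNG _ Nh; rewrite -!repr_mxM //.
    by have /centerP [_ ->] := subsetP sNZ _ Nh.
  rewrite !mxE (bigD1 i) //= [RHS](bigD1 k) //= !big1 ?addr0 => [|j nejk|j neji].
  - rewrite mulrC => /(mulIf nz_ki) /eqP; rewrite !cE (eq_prim_root_expr prim_z).
    by rewrite !modn_small // => /eqP.
  - by rewrite diag_h ?mul0r // eq_sym.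
  - by rewrite diag_h ?mulr0.
have diag_ext x : x \in N -> is_diag_mx (ext_rho D sV x).
  move=> Nx; rewrite is_diag_block_mx // !eqxx diagV // andbT.
  by rewrite scalar_mx_is_diag.
have cE_ext i l : ext_rho D sV (h l) i i = z ^+ ext_weight c i l.
  case: (split_ordP i) => j ->; rewrite /ext_rho.
    by rewrite block_mxEul mxE eqxx ext_weightl.
  by rewrite block_mxEdr ext_weightr cE.
have val_ii (l : 'I_D) : lshift n l = l :> nat by [].
have lead_ii e (w : 'M_(m, e)) k l :
    mlead (lin_comb (ext_phi psi c) w k) (lshift n l) =
    weight (ext_weight c) (lin_comb (ext_phi psi c) w k) l.
  by rewrite lin_comb_comp ext_lead_weight.
have rho_ii g k i l : g \in G -> ext_rho D sV g k i != 0 ->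
    (k == lshift n l) = (i == lshift n l).
  move=> _; rewrite /ext_rho; case: (split_ordP k) => k' ->; case: (split_ordP i) => i' ->.
  - by rewrite block_mxEul mxE; case: (k' =P i') => [->|]; rewrite ?eqxx.
  - by rewrite block_mxEur mxE eqxx.
  - by rewrite block_mxEdl mxE eqxx.
  - by rewrite !eq_rlshift.
apply/centsP => x Gx y Gy.
have le_ext : lin_trdeg_le (ext_phi psi c) D by apply: lin_trdeg_le_comp.
exact: (commutator_trivial (ii := fun l => lshift n l) (ext_equivariant eqv c_rho)
  (ext_faithful faith) p_pr prim_z sNG hN h_free diag_ext diagW cE_ext val_ii lead_ii
  rho_ii le_ext Gx Gy).
Qed.

End Conclusions.

(** * Faithful irreducible representations *)

Section FaithfulFromFunction.
Variables (F : numClosedFieldType) (gT : finGroupType) (G : {group gT}).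

(** For [x] read in the group algebra, this says that the averaging idempotent of M kills [x].
    Testing only M inside [S] allows [S] to be enlarged step by step. *)
Definition averages_vanish (x : gT -> F) (S : {set gT}) : Prop :=
  forall M : {group gT}, minnormal M G -> M \subset S ->
    forall g, \sum_(m in M) x (g * m)%g = 0.

Lemma averages_vanish_faithful x a : a \in G -> x a != 0 ->
  averages_vanish x G -> faithful_group F G.
Proof.
move=> Ga nz_xa vanish_x; pose aG := regular_repr F G.
pose v : 'rV[F]_(gcard G) := \row_i x (enum_val i).
have vE h j : h \in G -> (v *m aG h) 0 j = x (enum_val j * h^-1)%g.
  move=> Gh; have Gjh : (enum_val j * h^-1)%g \in G by rewrite groupM ?groupV ?enum_valP.
  rewrite mxE (bigD1 (gring_index G (enum_val j * h^-1)%g)) //= !mxE gring_indexK //.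
  rewrite mulgKV gring_valK !eqxx mulr1 big1 ?addr0 // => i nei.
  rewrite !mxE /=; case: eqP => [def_j|]; last by rewrite mulr0.
  case/eqP: nei; rewrite def_j gring_indexK ?groupM ?enum_valP // mulgK.
  by rewrite gring_valK.
(* |M| times the averaging idempotent, which commutes with the enveloping algebra when M is
   normal. *)
pose E (M : {group gT}) := \sum_(m in M) aG m.
have vE0 (M : {group gT}) : minnormal M G -> M \subset G -> v *m E M = 0.
  move=> minM sMG; apply/rowP=> j; rewrite mulmx_sumr summxE mxE.
  rewrite -[RHS](vanish_x M minM sMG (enum_val j)).
  rewrite (reindex_inj invg_inj) /=; apply: eq_big => m; first by rewrite groupV.
  by rewrite groupV => Mm; rewrite vE ?groupV ?(subsetP sMG) // invgK.
have EC (M : {group gT}) A : minnormal M G -> M \subset G ->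
    (A \in enveloping_algebra_mx aG)%MS -> A *m E M = E M *m A.
  move=> /mingroupp /andP [_ nMG] sMG /envelop_mxP [c ->].
  rewrite mulmx_suml [RHS]mulmx_sumr; apply: eq_bigr => g Gg.
  rewrite -scalemxAl -scalemxAr mulmx_sumr mulmx_suml; congr (_ *: _).
  rewrite [LHS](reindex_inj (conjg_inj g)) /=; apply: eq_big => [m | m Mm].
    by rewrite memJ_norm // (subsetP nMG).
  have Gm : m \in G by rewrite -(groupJr m Gg) (subsetP sMG).
  by rewrite -!repr_mxM ?groupJ // -conjgC.
have nz_v : v != 0.
  apply: contraNneq nz_xa => v0; have /rowP/(_ (gring_index G a)) := v0.
  by rewrite !mxE gring_indexK // => ->.
have [|V simV sVU] := dec_mxsimple_exists (cyclic_mx_module aG v); first by rewrite cyclic_mx_eq0.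
have [modV nzV _] := simV.
exists (\rank V), (submod_repr modV); split; first exact/submod_mx_irr.
rewrite /mx_faithful rker_submod; apply/negPn/negP => nt_ker.
(* A nontrivial kernel contains a minimal normal M. It fixes V pointwise, so [E M] is |M| on V,
   whereas [E M] kills [v] and hence the module generated by [v]. *)
have [||M minM sMK] := @minnormal_exists _ G (rstab_group aG V).
- by rewrite -subG1.
- exact: rstab_norm.
have sMG : M \subset G := subset_trans sMK (rstab_sub _ _).
case/eqP: nzV; apply/row_matrixP=> i; rewrite row0.
have : row i V *m E M = #|M|%:R *: row i V.
  rewrite mulmx_sumr (eq_bigr (fun=> row i V)) ?sumr_const ?scaler_nat // => m Mm.
  by rewrite -row_mul; have /rstab_act -> := subsetP sMK _ Mm.
have /cyclic_mxP [A envA ->] : (row i V <= cyclic_mx aG v)%MS.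
  exact: submx_trans (row_sub _ _) sVU.
rewrite -[LHS]mulmxA EC // mulmxA vE0 // mul0mx => /esym/eqP.
by rewrite scaler_eq0 pnatr_eq0 (gtn_eqF (cardG_gt0 M)) => /eqP.
Qed.
End FaithfulFromFunction.

(** * Minimal normal subgroups *)

Section MinimalNormal.
Variables (gT : finGroupType) (G : {group gT}).
Implicit Types (M K A B : {group gT}).

Lemma minnormal_norm M : minnormal M G -> G \subset 'N(M)%g.
Proof. by case/mingroupp/andP. Qed.

Lemma minnormal_nt M : minnormal M G -> M :!=: 1%g.
Proof. by case/mingroupp/andP. Qed.

Lemma minnormal_eq M K : minnormal M G -> K \subset M -> K :!=: 1%g ->
  G \subset 'N(K)%g -> K :=: M.
Proof. by case/mingroupP=> _ minM sKM ntK nKG; apply: minM; rewrite // ntK. Qed.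

Lemma minnormal_TI M K : minnormal M G -> G \subset 'N(K)%g -> ~~ (M \subset K) ->
  (M :&: K = 1)%g.
Proof.
move=> minM nKG not_sMK; apply/eqP; apply: contraR not_sMK => nt_MK.
have <- : (M :&: K)%G :=: M; last exact: subsetIr.
by apply: minnormal_eq; rewrite ?subsetIl //= normsI // minnormal_norm.
Qed.

Lemma normal_TI_cent A B : G \subset 'N(A)%g -> G \subset 'N(B)%g ->
  A \subset G -> B \subset G -> (A :&: B = 1)%g -> A \subset 'C(B)%g.
Proof.
move=> nAG nBG sAG sBG tiAB; apply/commG1P/trivgP; rewrite -tiAB subsetI.
by rewrite commg_subl commg_subr (subset_trans sBG) // (subset_trans sAG).
Qed.

End MinimalNormal.

Section AveragesVanish.
Variables (F : numClosedFieldType) (gT : finGroupType) (G : {group gT}).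
Implicit Types (M K L N S : {group gT}).

Definition separated S : Prop :=
  exists x : gT -> F, [/\ forall g, x g != 0 -> g \in S, exists g, x g != 0 &
    averages_vanish G x S].

(* Witness: x = #|N : L| 1_L - 1_N. As every M is a complement of L in N, each
   coset of M in N meets L exactly once. *)
Lemma separated_complement N L : L \proper N ->
  (forall M, minnormal M G -> M \subset N -> (L :&: M = 1 /\ L * M = N)%g) ->
  separated N.
Proof.
move=> /properP [sLN [y Ny notLy]] compl.
pose x g : F := #|N : L|%g%:R * (g \in L)%:R - (g \in N)%:R.
have gt1 : (1 < #|N : L|%g)%N.
  by rewrite indexg_gt1; apply/subsetPn; exists y.
exists x; split=> [g|| M minM sMN g].
- by apply: contraR => notNg; rewrite /x (negPf notNg) (negPf (contra (subsetP sLN g) notNg))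
    mulr0 subrr eqxx.
- exists 1%g; rewrite /x !group1 mulr1 subr_eq0 -[1](mulr1n 1) eqr_nat.
  by rewrite gtn_eqF.
have [tiLM defN] := compl M minM sMN.
have [Ng|notNg] := boolP (g \in N); last first.
  rewrite big1 // => m Mm; have /negPf nN : (g * m)%g \notin N.
    by rewrite groupMr // (subsetP sMN m Mm).
  have /negPf nL : (g * m)%g \notin L by apply: contraFN nN; apply: subsetP.
  by rewrite /x nN nL mulr0 subrr.
have /mulsgP [l m0 Ll Mm0 def_g] : g \in (L * M)%g by rewrite defN.
rewrite big_split /= -mulr_sumr sumrN.
have -> : \sum_(m in M) ((g * m)%g \in N)%:R = #|M|%:R :> F.
  rewrite -sum1_card natr_sum; apply: eq_bigr => m Mm.
  by rewrite groupM // (subsetP sMN m Mm).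
have -> : \sum_(m in M) ((g * m)%g \in L)%:R = 1 :> F.
  rewrite (bigD1 (m0^-1)%g) ?groupV //= def_g mulgK Ll big1 ?addr0 // => m /andP [Mm ne_m].
  rewrite -mulgA groupMl //; case: (boolP (_ \in L)) => // Lm0m.
  have : (m0 * m)%g \in (L :&: M)%g by rewrite inE Lm0m groupM.
  by rewrite tiLM inE -eq_invg_mul eq_sym (negPf ne_m).
have -> : #|N : L|%g = #|M|.
  apply/eqP; rewrite -(eqn_pmul2l (cardG_gt0 L)) Lagrange // -defN TI_cardMg //.
by rewrite mulr1 subrr.
Qed.

(** Witness: the convolution of x and y. Averages over M in N reach y directly, those over M in S
    reach x because S centralizes N. The value at a0 b0 is nonzero since factorizations in S N are
    unique. *)
Lemma separated_prod S N K : S \subset 'C(N)%g -> (S :&: N = 1)%g -> (S * N = K)%g ->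
  (forall M, minnormal M G -> M \subset K -> M \subset S \/ M \subset N) ->
  separated S -> separated N -> separated K.
Proof.
move=> cSN tiSN defK sub_or [x [supp_x [a0 nz_a0] van_x]] [y [supp_y [b0 nz_b0] van_y]].
pose conv g := \sum_(a : gT) x a * y (a^-1 * g)%g.
have convE g : conv g = \sum_(b : gT) x (g * b^-1)%g * y b.
  rewrite /conv (reindex_inj (inj_comp (mulgI g) invg_inj)) /=.
  by apply: eq_bigr => b _; rewrite invMg invgK mulgKV.
have Sa0 := supp_x _ nz_a0; have Nb0 := supp_y _ nz_b0.
exists conv; split=> [g nz_g||M minM sMK g].
- have [a /andP [_ nz_a]] : exists a : gT, true && (x a * y (a^-1 * g)%g != 0).
    apply/existsP; apply: contraR nz_g; rewrite negb_exists => /forallP all0.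
    by apply/eqP; apply: big1 => a _; apply/eqP; rewrite -[_ == 0]negbK; apply: all0.
  move: nz_a; rewrite mulf_eq0 negb_or => /andP [/supp_x Sa /supp_y Nag].
  by rewrite -defK; apply/mulsgP; exists a (a^-1 * g)%g; rewrite ?mulKVg.
- exists (a0 * b0)%g; rewrite /conv (bigD1 a0) //= mulKg big1 ?addr0 ?mulf_neq0 // => a ne_a.
  apply/eqP; apply: contraR ne_a; rewrite mulf_eq0 negb_or => /andP [/supp_x Sa /supp_y].
  rewrite mulgA groupMr // => Naa0; rewrite eq_mulVg1.
  have : (a^-1 * a0)%g \in (S :&: N)%g by rewrite inE Naa0 groupM ?groupV.
  by rewrite tiSN inE.
have [sMS|sMN] := sub_or M minM sMK; last first.
  rewrite /conv exchange_big big1 //= => a _.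
  under eq_bigr do rewrite mulgA; rewrite -mulr_sumr.
  by rewrite (van_y M minM sMN) mulr0.
under eq_bigr do rewrite convE; rewrite exchange_big big1 //= => b _.
have [->|nz_b] := eqVneq (y b) 0; first by rewrite big1 // => m _; rewrite mulr0.
rewrite -mulr_suml; have Nb := supp_y _ nz_b.
rewrite (eq_bigr (fun m => x (g * b^-1 * m)%g)) => [|m Mm].
  by rewrite (van_x M minM sMS) mul0r.
have /centP cm := subsetP cSN _ (subsetP sMS _ Mm).
by rewrite -!mulgA; congr (x (_ * _)%g); apply: cm; rewrite groupV.
Qed.

End AveragesVanish.

(** * Induction over minimal normal subgroups *)

Section Construction.
Variables (F : numClosedFieldType) (gT : finGroupType) (G : {group gT}).
Implicit Types (M K L N S : {group gT}).
Local Notation separated := (separated F G).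
Local Open Scope group_scope.

Definition scalar_plane (p : nat) N : Prop :=
  [/\ prime p, (p.-abelem N)%g, #|N| = (p ^ 2)%N, N \subset G &
    forall L, L \subset N -> #|L| = p -> G \subset 'N(L)%g].

Hypothesis rank2 : forall p d N, prime p -> (p.-abelem N)%g -> #|N| = (p ^ d)%N ->
  N \subset G -> (d <= 2)%N.

Lemma minnormal_abelem (p : nat) M : minnormal M G -> (p.-group M)%g -> (p.-abelem M)%g.
Proof.
move=> minM pM; have [_ _] := minnormal_solvable minM (subxx M) (pgroup_sol pM).
by rewrite (is_abelem_pgroup pM).
Qed.

Lemma minnormal_card (p : nat) M : prime p -> minnormal M G -> (p.-group M)%g ->
  exists2 k, (0 < k)%N & #|M| = (p ^ k)%N.
Proof.
move=> p_pr minM pM; have [_ _ [k cardM]] := pgroup_pdiv pM (minnormal_nt minM).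
by exists k.+1.
Qed.

Lemma joined_abelem (p : nat) M K : minnormal M G -> M \subset G -> (p.-group M)%g ->
  (p.-abelem K)%g -> K \subset G -> G \subset 'N(K)%g -> ~~ (M \subset K) ->
  (p.-abelem (K <*> M))%g /\ #|K <*> M|%g = (#|K| * #|M|)%N.
Proof.
move=> minM sMG pM abelK sKG nKG not_sMK.
have tiKM : (K :&: M = 1)%g by rewrite setIC (minnormal_TI minM).
have cMK : M \subset 'C(K)%g.
  by apply: (normal_TI_cent (minnormal_norm minM)) => //; rewrite setIC.
have defKM : (K \x M = K <*> M)%g by rewrite dprodEY.
rewrite (dprod_abelem _ defKM) abelK (minnormal_abelem minM pM).
by rewrite -(dprod_card defKM).
Qed.

(** If M is the only minimal normal p-subgroup, N = M works, with complement 1. Otherwise two of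
    them span a plane K, which by [rank2] contains all the others; either every line of K is
    G-stable, or an unstable line separates K. *)
Lemma p_block (p : nat) M : prime p -> minnormal M G -> M \subset G -> (p.-group M)%g ->
  (exists N, scalar_plane p N) \/
  exists N, [/\ separated N, G \subset 'N(N)%g, N \subset G, (p.-group N)%g &
    forall M', minnormal M' G -> M' \subset G -> (p.-group M')%g -> M' \subset N].
Proof.
move=> p_pr minM sMG pM; have abelM := minnormal_abelem minM pM.
have [/existsP [M1 /and4P [minM1 sM1G pM1 neM1]]|] :=
  boolP [exists M1 : {group gT}, [&& minnormal M1 G, M1 \subset G, (p.-group M1)%g & M1 != M]]; last first.
  move=> noM1; right; exists M; split=> //; last first.
  - move=> M' minM' sM'G pM'; apply: contraR noM1 => not_sM'M; apply/existsP; exists M'.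
    rewrite minM' sM'G pM' /=; apply: contra not_sM'M => /eqP ->; exact: subxx.
  - exact: minnormal_norm.
  apply: (@separated_complement F gT G M 1%G) => [|M' minM' sM'M].
    by rewrite proper1G (minnormal_nt minM).
  have defM' : M' :=: M.
    by apply: (minnormal_eq minM) => //; [apply: minnormal_nt minM' | apply: minnormal_norm].
  by rewrite setI1g mul1g.
have not_sM1M : ~~ (M1 \subset M).
  apply: contra neM1 => sM1M; apply/eqP/val_inj.
  by apply: (minnormal_eq minM) => //; [apply: minnormal_nt minM1 | apply: minnormal_norm].
pose K := (M <*> M1)%G.
have [abelK cardK] := joined_abelem minM1 sM1G pM1 abelM sMG (minnormal_norm minM) not_sM1M.
have [a a_gt0 cardM] := minnormal_card p_pr minM pM.
have [b b_gt0 cardM1] := minnormal_card p_pr minM1 pM1.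
have sKG : K \subset G by rewrite join_subG sMG.
have nKG : G \subset 'N(K)%g by rewrite normsY ?minnormal_norm.
have cardKab : #|K| = (p ^ (a + b))%N by rewrite cardK cardM cardM1 expnD.
have ab2 : (a + b)%N = 2.
  apply/eqP; rewrite eqn_leq (rank2 p_pr abelK cardKab sKG).
  by rewrite -[2%N]/(1 + 1)%N leq_add.
have sub_K M' : minnormal M' G -> M' \subset G -> (p.-group M')%g -> M' \subset K.
  move=> minM' sM'G pM'; apply/negPn/negP => not_sM'K.
  have [abelKM' cardKM'] := joined_abelem minM' sM'G pM' abelK sKG nKG not_sM'K.
  have [e e_gt0 cardM'] := minnormal_card p_pr minM' pM'.
  have : #|K <*> M'|%g = (p ^ (2 + e))%N by rewrite cardKM' cardKab ab2 cardM' expnD.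
  have sKM'G : (K <*> M')%g \subset G by rewrite join_subG sKG.
  by move/(fun c => rank2 p_pr abelKM' c sKM'G); rewrite -[X in (_ <= X)%N]addn0 leq_add2l leqNgt e_gt0.
have cardKp : #|K| = (p ^ 2)%N by rewrite cardKab ab2.
(* One of order p^2 would be all of K and contain M properly. *)
have card_min M' : minnormal M' G -> M' \subset K -> #|M'| = p.
  move=> minM' sM'K.
  have pM' : (p.-group M')%g := pgroupS sM'K (abelem_pgroup abelK).
  have [[|[|e]] // e_gt0 cardM'] := minnormal_card p_pr minM' pM'.
  have defM' : M' :=: K.
    by apply/eqP; rewrite eqEcard sM'K cardKp cardM' leq_exp2l // prime_gt1.
  have sMM' : M \subset M' by rewrite defM' joing_subl.
  have defM : M :=: M'.
    by rewrite (minnormal_eq minM' sMM' (minnormal_nt minM) (minnormal_norm minM)).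
  by case/negP: not_sM1M; rewrite defM defM' joing_subr.
have [/forallP all_norm|] := boolP [forall L : {group gT}, (L \subset K) && (#|L| == p) ==> (G \subset 'N(L)%g)].
  left; exists K; split=> // L sLK cardL; have := all_norm L.
  by rewrite sLK cardL eqxx.
rewrite negb_forall => /existsP [L]; rewrite negb_imply => /andP [/andP [sLK /eqP cardL] not_nLG].
right; exists K; split=> //; last exact: abelem_pgroup abelK.
(* Not being G-stable, the line L differs from every minimal normal subgroup of K; these are lines
   too, so L complements each. *)
apply: (@separated_complement F gT G K L) => [|M' minM' sM'K].
  rewrite properEcard sLK cardL cardKp -{1}[p]expn1 ltn_exp2l //; exact: prime_gt1.
have cardM' := card_min M' minM' sM'K.
have tiLM' : (L :&: M' = 1)%g.
  apply: prime_TIg; first by rewrite cardL.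
  apply: contra not_nLG => sLM'; have -> : L :=: M'.
    by apply/eqP; rewrite eqEcard sLM' cardL cardM' leqnn.
  exact: minnormal_norm.
split=> //; apply/eqP; rewrite eqEcard mul_subG //= TI_cardMg // cardL cardM' cardKp.
by rewrite mulnn.
Qed.

(** For each p, S contains all minimal normal p-subgroups of G or none. *)
Definition saturated S : Prop := forall (p : nat) M1 M2, prime p ->
  minnormal M1 G -> M1 \subset G -> (p.-group M1)%g ->
  minnormal M2 G -> M2 \subset G -> (p.-group M2)%g -> M1 \subset S -> M2 \subset S.

(* A minimal normal subgroup of S N not contained in S embeds in N, hence is a
   p-group. *)
Lemma extend_p_block (p : nat) S N M : prime p -> S \subset G -> G \subset 'N(S)%g ->
  separated S -> saturated S -> separated N -> G \subset 'N(N)%g -> N \subset G ->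
  (p.-group N)%g ->
  (forall M', minnormal M' G -> M' \subset G -> (p.-group M')%g -> M' \subset N) ->
  minnormal M G -> M \subset G -> (p.-group M)%g -> ~~ (M \subset S) ->
  separated (S <*> N)%G /\ saturated (S <*> N)%G.
Proof.
move=> p_pr sSG nSG sepS satS sepN nNG sNG pN allN minM sMG pM not_sMS.
(* A minimal normal subgroup inside the intersection would be a p-group in S, and saturation would
   put M in S. *)
have tiSN : (S :&: N = 1)%g.
  apply/eqP; apply: contraR not_sMS => nt_SN.
  have nSNG : G \subset 'N(S :&: N)%g by rewrite normsI.
  have [M1 minM1 /subsetIP [sM1S sM1N]] := @minnormal_exists _ G (S :&: N)%G nt_SN nSNG.
  apply: (satS p M1 M) => //; first exact: subset_trans sM1S sSG.
  exact: pgroupS sM1N pN.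
have cSN : S \subset 'C(N)%g := normal_TI_cent nSG nNG sSG sNG tiSN.
have defSN : (S * N = S <*> N)%g by rewrite -cent_joinEl.
have sub_or M' : minnormal M' G -> M' \subset S <*> N -> M' \subset S \/ M' \subset N.
  move=> minM' sM'SN; have [|not_sM'S] := boolP (M' \subset S); [by left | right].
  have sM'G : M' \subset G by rewrite (subset_trans sM'SN) // join_subG sSG.
  apply: allN => //; apply: (@pnat_dvd _ #|N|) => //.
  have tiM'S : (M' :&: S = 1)%g := minnormal_TI minM' nSG not_sM'S.
  have cardSN : #|S <*> N| = (#|S| * #|N|)%N by rewrite -defSN TI_cardMg.
  rewrite -(dvdn_pmul2l (cardG_gt0 S)) -cardSN mulnC -(TI_cardMg tiM'S).
  rewrite -norm_joinEl ?(subset_trans sM'G nSG) //.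
  by apply: cardSg; rewrite join_subG sM'SN joing_subl.
split; first exact: (@separated_prod F gT G S N (S <*> N)%G cSN tiSN defSN sub_or).
move=> q M1 M2 q_pr minM1 sM1G qM1 minM2 sM2G qM2 sM1SN.
have [sM1S|sM1N] := sub_or M1 minM1 sM1SN.
  by apply: subset_trans (joing_subl S N); apply: (satS q M1 M2).
apply: subset_trans (joing_subr S N); apply: allN => //.
have [_ q_dvd _] := pgroup_pdiv qM1 (minnormal_nt minM1).
have /eqP <- : q == p by apply: (pgroupP (pgroupS sM1N pN) q).
exact: qM2.
Qed.

(** M has trivial center. A minimal normal subgroup of S M lying in neither factor would centralize
    both, hence lie in Z(S M) = Z(S), inside S. *)
Lemma extend_nonabelian S M : S \subset G -> G \subset 'N(S)%g ->
  separated S -> saturated S -> minnormal M G -> M \subset G ->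
  (forall p : nat, prime p -> ~~ (p.-group M)%g) -> ~~ (M \subset S) ->
  separated (S <*> M)%G /\ saturated (S <*> M)%G.
Proof.
move=> sSG nSG sepS satS minM sMG not_pM not_sMS; have nMG := minnormal_norm minM.
have tiSM : (S :&: M = 1)%g by rewrite setIC (minnormal_TI minM).
have cSM : S \subset 'C(M)%g := normal_TI_cent nSG nMG sSG sMG tiSM.
have defSM : (S * M = S <*> M)%g by rewrite -cent_joinEl.
have ZM1 : ('Z(M) = 1)%g.
  apply/eqP; apply/negPn/negP => ntZ.
  have defZ : 'Z(M)%g = M.
    apply: (@minnormal_eq _ G M 'Z(M)%G) => //; first exact: center_sub.
    exact: gFnorm_trans nMG.
  have abelM : abelian M by rewrite -defZ center_abelian.
  have [_ _ /is_abelemP [p p_pr /abelem_pgroup]] :=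
    minnormal_solvable minM (subxx M) (abelian_sol abelM).
  by apply/negP; apply: not_pM.
have sub_or M' : minnormal M' G -> M' \subset S <*> M -> M' \subset S \/ M' \subset M.
  move=> minM' sM'SM; have [|not_sM'S] := boolP (M' \subset S); [by left | right].
  apply/negPn/negP => not_sM'M; case/negP: (not_sM'S).
  have sM'G : M' \subset G by rewrite (subset_trans sM'SM) // join_subG sSG.
  have nM'G := minnormal_norm minM'.
  have cM'S : M' \subset 'C(S)%g.
    exact: (normal_TI_cent nM'G nSG sM'G sSG (minnormal_TI minM' nSG not_sM'S)).
  have cM'M : M' \subset 'C(M)%g.
    exact: (normal_TI_cent nM'G nMG sM'G sMG (minnormal_TI minM' nMG not_sM'M)).
  have defd : (S \x M = S <*> M)%g by rewrite dprodEY // centsC.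
  have : M' \subset 'Z(S <*> M)%g by rewrite subsetI sM'SM centY subsetI cM'S.
  by rewrite -(center_dprod defd) ZM1 dprodg1 => /subset_trans; apply; apply: center_sub.
split.
  apply: (@separated_prod F gT G S M (S <*> M)%G cSM tiSM defSM sub_or sepS).
  apply: (@separated_complement F gT G M 1%G) => [|M' minM' sM'M].
    by rewrite proper1G (minnormal_nt minM).
  by rewrite setI1g mul1g (minnormal_eq minM sM'M (minnormal_nt minM') (minnormal_norm minM')).
move=> q M1 M2 q_pr minM1 sM1G qM1 minM2 sM2G qM2 sM1SM.
have [sM1S|sM1M] := sub_or M1 minM1 sM1SM.
  by apply: subset_trans (joing_subl S M); apply: (satS q M1 M2).
have defM1 := minnormal_eq minM sM1M (minnormal_nt minM1) (minnormal_norm minM1).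
by case/negP: (not_pM q q_pr); rewrite -defM1.
Qed.

(** Starting from 1, S absorbs new blocks until a scalar plane appears or S contains every minimal
    normal subgroup; in the latter case its witness gives a faithful irreducible representation. *)
Lemma faithful_or_scalar_plane :
  faithful_group F G \/ exists (p : nat) N, scalar_plane p N.
Proof.
have main k S : (#|G| - #|S| < k)%N -> S \subset G -> G \subset 'N(S)%g ->
    separated S -> saturated S -> faithful_group F G \/ exists (p : nat) N, scalar_plane p N.
  elim: k S => // k IHk S ltk sSG nSG sepS satS.
  have [/existsP [M /and3P [minM sMG not_sMS]]|all_sub] :=
    boolP [exists M : {group gT}, [&& minnormal M G, M \subset G & ~~ (M \subset S)]]; last first.
    left; have [x [supp_x [a nz_a] van_x]] := sepS.
    apply: (@averages_vanish_faithful F gT G x a) => //.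
      by apply: (subsetP sSG); apply: supp_x.
    move=> M minM sMG; apply: van_x => //; apply: contraR all_sub => not_sMS.
    by apply/existsP; exists M; rewrite minM sMG.
  have step N : N \subset G -> G \subset 'N(N)%g -> M \subset N ->
      separated (S <*> N)%G /\ saturated (S <*> N)%G ->
      faithful_group F G \/ exists (p : nat) N, scalar_plane p N.
    move=> sNG nNG sMN [sep sat]; apply: (IHk (S <*> N)%G) => //.
    - have prSN : S \proper S <*> N.
        rewrite properE joing_subl join_subG subxx /=; apply: contra not_sMS.
        exact: subset_trans.
      have sSNG : S <*> N \subset G by rewrite join_subG sSG.
      rewrite ltnS in ltk; apply: leq_trans ltk; apply: ltn_sub2l; last exact: proper_card.
      exact: leq_trans (proper_card prSN) (subset_leq_card sSNG).
    - by rewrite join_subG sSG.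
    - by rewrite normsY.
  have [p_group|not_p] := boolP [exists p : 'I_#|G|.+1, prime p && (p.-group M)%g].
    have [p /andP [p_pr pM]] := existsP p_group.
    have [[N plane]|[N [sepN nNG sNG pN allN]]] := p_block p_pr minM sMG pM.
      by right; exists p, N.
    apply: (step N) => //; first exact: allN.
    exact: (extend_p_block p_pr sSG nSG sepS satS sepN nNG sNG pN allN minM sMG pM).
  apply: (step M) => //; first exact: minnormal_norm.
  apply: extend_nonabelian => // p p_pr; apply: contra not_p => pM.
  have [_ p_dvd _] := pgroup_pdiv pM (minnormal_nt minM).
  have lep : (p < #|G|.+1)%N.
    by rewrite ltnS dvdn_leq ?cardG_gt0 // (dvdn_trans p_dvd) // cardSg.
  by apply/existsP; exists (Ordinal lep); rewrite p_pr.
apply: (main #|G|.+1 1%G); rewrite ?sub1G ?norms1 ?ltnS ?leq_subr //.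
  (* The unit of the group algebra: no minimal normal subgroup lies in 1. *)
  exists (fun g => (g == 1%g)%:R); split=> [g|| M minM].
  - by case: (g =P 1%g) => [->|]; rewrite ?group1 ?eqxx.
  - by exists 1%g; rewrite eqxx oner_eq0.
  - by move/trivgP => M1; have := minnormal_nt minM; rewrite M1 eqxx.
move=> p M1 M2 _ minM1 _ _ _ _ _ /trivgP M1_1.
by have := minnormal_nt minM1; rewrite M1_1 eqxx.
Qed.

End Construction.

(** Independent elements a, b and their product ab are each sent to powers of themselves; comparing
    components in <a> and <b> makes the three exponents act alike. *)
Lemma scalar_plane_action (gT : finGroupType) (G N : {group gT}) p g :
  scalar_plane G p N -> g \in G -> exists t, {in N, forall x, x ^ g = x ^+ t}%g.
Proof.
case=> p_pr abelN cardN sNG lines Gg.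
have abN := centsP (abelem_abelian abelN).
have ntN : N :!=: 1%g by rewrite -cardG_gt1 cardN (ltn_exp2l 0) ?prime_gt1.
have [a Na nt_a] := trivgPn _ ntN.
have oa := abelem_order_p abelN Na nt_a.
have [b Nb not_ab] : exists2 b, b \in N & b \notin <[a]>%g.
  apply/subsetPn; apply: contraTN isT => sNa; have := subset_leq_card sNa.
  by rewrite cardN -orderE oa -{2}[p]expn1 leq_exp2l // prime_gt1.
have nt_b : b != 1%g by apply: contraNneq not_ab => ->; rewrite group1.
have pow x : x \in N -> x != 1%g -> exists i, (x ^ g = x ^+ i)%g.
  move=> Nx nt_x; apply/cycleP; have ox := abelem_order_p abelN Nx nt_x.
  have sxN : <[x]>%g \subset N by rewrite cycle_subG.
  by rewrite memJ_norm ?cycle_id // (subsetP (lines <[x]>%G sxN _)).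
have [i ai] := pow a Na nt_a; have [j bj] := pow b Nb nt_b.
have cab : commute a b by apply: abN.
have nt_ab : (a * b != 1)%g.
  by apply: contraNneq not_ab => /(canRL (mulKg a)); rewrite mulg1 => ->; rewrite groupV cycle_id.
have [k abk] := pow (a * b)%g (groupM Na Nb) nt_ab.
have tiab : (<[b]> :&: <[a]> = 1)%g.
  by apply: prime_TIg; rewrite -?orderE ?(abelem_order_p abelN Nb nt_b) // cycle_subG.
have eq_abk : ((a ^+ k)^-1 * a ^+ i = b ^+ k * (b ^+ j)^-1)%g.
  apply: (mulgI (a ^+ k)%g); apply: (mulIg (b ^+ j)%g).
  by rewrite !mulgA mulgV mul1g mulgKV -expgMn // -abk conjMg ai bj.
have a_ki : ((a ^+ k)^-1 * a ^+ i = 1)%g.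
  apply/set1gP; rewrite -tiab inE {1}eq_abk.
  by rewrite !groupM ?groupV ?groupX ?cycle_id.
have aik : (a ^ g = a ^+ k)%g by rewrite ai -[LHS](mulKVg (a ^+ k)%g) a_ki mulg1.
have bjk : (b ^ g = b ^+ k)%g.
  by rewrite bj; apply/esym/eqP; rewrite eq_mulgV1 -eq_abk a_ki.
exists k => x; have -> : N :=: (<[a]> * <[b]>)%g.
  apply/eqP; rewrite eq_sym eqEcard mul_subG ?cycle_subG //= TI_cardMg; last by rewrite setIC.
  by rewrite -!orderE oa (abelem_order_p abelN Nb nt_b) cardN mulnn.
case/mulsgP=> _ _ /cycleP [r ->] /cycleP [s ->] ->.
rewrite conjMg !conjXg aik bjk expgMn; last by apply: commuteX2.
by rewrite -!expgM ![(k * _)%N]mulnC.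
Qed.

(* Non-faithful groups of covariant dimension 2 *)
Local Close Scope ring_scope.

Theorem theorem7p1 (R : realType) (gT : finGroupType) (G : {group gT}) :
  ~ faithful_group (complex R) G ->
  has_covariant_dim (complex R) G 2 ->
  abelian G /\ 'm(G)%g = 2.
Proof.
move=> not_faithful [[n [m [rV [rW [phi [fcov dim2]]]]]] _].
have le2 := has_dim_lin_trdeg dim2.
have rank2 p d (N : {group gT}) : prime p -> (p.-abelem N)%g -> #|N| = (p ^ d)%N ->
    N \subset G -> (d <= 2)%N.
  exact: (abelem_logn_le fcov le2).
have [//|[p [N plane]]] := faithful_or_scalar_plane (complex R) rank2.
have [p_pr abelN cardN sNG _] := plane.
have abG : abelian G.
  (* G acts on the plane N by powers, and [scalar_action_trivial] forces these actions to be
     trivial, so N is central. *)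
  apply: (central_abelem_abelian fcov le2 p_pr abelN cardN).
  rewrite subsetI sNG; apply/centsP => x Nx g Gg.
  have [t conj_g] := scalar_plane_action plane Gg.
  have fix_g := scalar_action_trivial fcov le2 p_pr abelN cardN sNG isT Gg conj_g.
  by rewrite /commute conjgC fix_g.
(* The rank of G is attained by an elementary abelian subgroup, bounded through [rank2]; N gives the
   reverse inequality. *)
split=> //; rewrite grank_abelian //; apply/eqP; rewrite eqn_leq; apply/andP; split.
  have [q q_pr ->] := rank_witness G; have [E EqE] := p_rank_witness q G.
  have [sEG abelE logE] := pnElemP EqE.
  apply: (rank2 q _ E q_pr abelE _ sEG).
  by rewrite -logE -p_part (part_pnat_id (abelem_pgroup abelE)).
by apply: leq_trans (rankS sNG); rewrite (rank_abelem abelN) cardN pfactorK.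
Qed.
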